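(* Let $0<\alpha\leq 1$ and let $(X_n)_{n\geq 0}$, $(Y_n)_{n\geq 0}$, $(Z_n)_{n\geq 0}$ be independent simple random walks on the graph $\mathrm{Comb}_{\ell}(\mathbb{Z},\alpha)$, all started at $\mathbf{0}=(0,0)$, with joint law $\mathbb{P}^{\mathbf{0},\mathbf{0},\mathbf{0}}$. For $N\in\mathbb{N}$ let \[C_N=\sum_{n=1}^{N}\mathbf{1}_{\{X_n=Y_n=Z_n\}}\] be the number of triple collisions up to time $N$. Then, $\mathbb{P}^{\mathbf{0},\mathbf{0},\mathbf{0}}$-almost-surely, \[\limsup_{N\rightarrow\infty}\frac{C_N}{\log^{1-\alpha}(N)\vee\log\log(N)}>0.\]
   Context: $\log^{\beta}(t)$ means $(\log t)^{\beta}$, and $a\vee b=\max\{a,b\}$. The graph $\mathrm{Comb}_{\ell}(\mathbb{Z},\alpha)$ has vertex set $\{(n,x)\in\mathbb{Z}^2: 0\leq x\leq 0\vee\log^{\alpha}(|n|)\}$, where the upper bound is read as $0$ when $n=0$. Its edges are the horizontal edges between $(n,0)$ and $(n+1,0)$ for all $n\in\mathbb{Z}$, and the vertical edges between $(n,x)$ and $(n,x+1)$ whenever both are vertices. A simple random walk on this graph is the discrete-time Markov chain which at each step moves to a uniformly chosen neighbour of its current vertex. *)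

(* Defs.v *)
From HB Require Import structures.
From mathcomp Require Import all_boot all_order all_algebra.
From mathcomp Require Import finmap.
From mathcomp Require Import all_classical all_reals all_analysis.

Set Implicit Arguments.
Unset Strict Implicit.
Unset Printing Implicit Defensive.

Import Order.TTheory GRing.Theory Num.Theory.

Local Open Scope classical_set_scope.
Local Open Scope ring_scope.

Section Comb.
Context {R : realType}.
Variable alpha : R.

Definition comb_height (n : int) : R :=
  if n == 0 then 0 else Num.max 0 (ln (absz n)%:R `^ alpha).

Definition comb_vertex (v : int * int) : bool :=
  (0 <= v.2) && (v.2%:~R <= comb_height v.1).

Definition comb_step (u v : int * int) : bool :=
  ((u.2 == 0) && (v == (u.1 + 1, 0))) || (v == (u.1, u.2 + 1)).

Definition comb_adj : rel (int * int) := fun u v =>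
  [&& comb_vertex u, comb_vertex v & comb_step u v || comb_step v u].

End Comb.

Section RandomWalk.
Context {R : realType} {V : choiceType}.
Variable adj : rel V.

Definition nbhd (v : V) : set V := [set w | adj v w].

(* Meaningful for locally finite graphs only: [fset_set] of an infinite set is
   empty. *)
Definition degree (v : V) : nat := #|` fset_set (nbhd v)|.

Definition srw_kernel (v w : V) : R := if adj v w then (degree v)%:R^-1 else 0.

Context {d : measure_display} {T : measurableType d}.
Variables (P : probability T R) (X : nat -> T -> V).

Definition cylinder (v : nat -> V) (n : nat) : set T :=
  [set t | forall i, (i <= n)%N -> X i t = v i].

(* The states carry the discrete sigma-algebra.  The Markov property is the
   conditional one, multiplied out by the probability of the past. *)
Definition simple_random_walk (o : V) : Prop :=
  [/\ forall n (A : set V), measurable (X n @^-1` A),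
      P (X 0%N @^-1` [set o]) = 1%E &
      forall (n : nat) (v : nat -> V),
        P (cylinder v n.+1) =
        (P (cylinder v n) * (srw_kernel (v n) (v n.+1))%:E)%E].

End RandomWalk.

(* [degree] is therefore the actual number of neighbours on the comb. *)
Lemma finite_nbhd_comb {R : realType} (alpha : R) (v : int * int) :
  finite_set (nbhd (comb_adj alpha) v).
Proof.
apply: (@sub_finite_set _ _ [set` [:: (v.1 + 1, 0); (v.1, v.2 + 1);
  (v.1 - 1, 0); (v.1, v.2 - 1)]]); last exact: finite_seq.
case: v => a b [c e] /= /and3P[_ _]; rewrite /comb_step /= !inE.
by case/orP => /orP[/andP[/eqP -> /eqP[-> ->]]|/eqP[-> ->]];
  rewrite ?addrK ?eqxx ?orbT.
Qed.

Section Independence.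
Context {R : realType} {d : measure_display} {T : measurableType d}.
Context {V : Type}.

Definition process_sigma (X : nat -> T -> V) : set (set T) :=
  <<s [set E | exists n (A : set V), E = X n @^-1` A] >>.

(* Taking one of the events to be setT gives the product rule for pairs. *)
Definition independent3 (P : probability T R) (X Y Z : nat -> T -> V) : Prop :=
  forall A B C : set T,
    process_sigma X A -> process_sigma Y B -> process_sigma Z C ->
    P (A `&` B `&` C) = (P A * P B * P C)%E.

End Independence.

Definition triple_collisions {T : Type} {V : eqType} (X Y Z : nat -> T -> V)
    (N : nat) (t : T) : nat :=
  (\sum_(1 <= n < N.+1) ((X n t == Y n t) && (Y n t == Z n t)))%N.

(* Main.v *)
Require Import Defs.
From HB Require Import structures.
From mathcomp Require Import all_boot all_order all_algebra.
From mathcomp Require Import finmap.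
From mathcomp Require Import all_classical all_reals all_analysis.
From mathcomp Require Import ring lra zify.

(** Let [e] be the comb, [h] the order of the height of its teeth at the distance
    reached by the walk at time [n], so that [h] is of order [log ^ alpha n].  The
    walk moves horizontally only when it is on the base, which is a fraction of
    order [1 / h] of the time; so at time [n] it has gone a distance of order
    [sqrt (n / h)], and it is spread over about [sqrt (n h)] vertices.  Three
    independent walks thus meet at time [n] with probability of order
    [sqrt (n h) ^ (1 - 3) = 1 / (n h)], and the expected number of collisions up to
    time [N] is of the order of the sum of [1 / (n log ^ alpha n)], which is
    [log ^ (1 - alpha) N] or [log log N].  It remains to show that this number of
    collisions is reached infinitely often.

    All expectations at finite times are computed with the averaging operator
    [avg], and three independent walks are treated as one walk on a product graph
    ([joint_srw], [srw_path]).

    Lower bound for the mean ([hits_lower]): the square of the horizontal position,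
    a function [tooth_clock] that measures the time spent in the teeth and a convex
    function [parabola] bound the displacement ([sq_dist_le]).  By Cauchy-Schwarz
    the return probability is then at least the inverse of the size of a box
    ([return_ge]), and since the Dirichlet form of the transition probabilities
    decays like the return probability divided by the time ([hit2_energy_le]), this
    bound persists near the starting point ([hit2_ge]).

    Upper bound for the mean ([hits_upper]): a point with many points nearby has a
    small return probability ([return_le]), by the same estimate on the Dirichlet
    form.  This bounds the mean number of collisions of walks that start together,
    uniformly over the starting points that can be reached.  Walks that start in a
    long tooth meet more often until they leave it; this adds the logarithm of the
    height of the tooth, of order [log log N], which is affordable.

    The uniform upper bound makes the second moment comparable with the square of
    the mean ([hits_second_moment]), so that from any starting point the number of
    collisions in a sufficiently long time is of the required order with
    probability at least [d], where [d] does not depend on the starting point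
    ([hits_likely]).  As only finitely many positions are possible at a given time,
    time can be cut into blocks such that each of them fails with conditional
    probability at most [1 - d]; almost surely they do not all fail from some block
    on ([missed_targets]). *)

Set Implicit Arguments.
Unset Strict Implicit.
Unset Printing Implicit Defensive.

Import Order.TTheory GRing.Theory Num.Theory.
Import numFieldNormedType.Exports.

Local Open Scope fset_scope.
Local Open Scope classical_set_scope.
Local Open Scope ring_scope.

(** * Averaging operator and transition probabilities *)

Section Averaging.
Context {R : realType} {V : choiceType} (e : rel V).
Hypothesis e_sym : symmetric e.
Hypothesis e_fin : forall v, finite_set (nbhd e v).

Definition nb (v : V) : {fset V} := fset_set (nbhd e v).

Lemma in_nb x y : (y \in nb x) = e x y.
Proof. by rewrite /nb in_fset_set //; apply/asboolP/idP. Qed.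

(** The mean of [f] one step away from [x]; [iter n avg f x] is then the mean of
    [f] at the position of the walk from [x] after [n] steps. *)
Definition avg (f : V -> R) (x : V) : R :=
  (degree e x)%:R^-1 * \sum_(y <- nb x) f y.

(** At an isolated point both sides vanish. *)
Lemma avgE f x : (degree e x)%:R * avg f x = \sum_(y <- nb x) f y.
Proof.
rewrite /avg mulrA; have [d0|d0] := eqVneq (degree e x) 0%N.
  by rewrite d0 mul0r mul0r /nb (cardfs0_eq d0) big_seq_fset0.
by rewrite mulfV ?mul1r // pnatr_eq0.
Qed.

Lemma eq_avg f g x : (forall y, e x y -> f y = g y) -> avg f x = avg g x.
Proof.
move=> fg; rewrite /avg; congr (_ * _).
by apply: eq_big_seq => y; rewrite in_nb; apply: fg.
Qed.

Lemma avg_le f g x : (forall y, e x y -> f y <= g y) -> avg f x <= avg g x.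
Proof.
move=> fg; rewrite /avg ler_wpM2l ?invr_ge0 //.
by rewrite big_seq [leRHS]big_seq; apply: ler_sum => y; rewrite in_nb; apply: fg.
Qed.

Lemma avgD f g x : avg (fun y => f y + g y) x = avg f x + avg g x.
Proof. by rewrite /avg big_split mulrDr. Qed.

Lemma avgZ c f x : avg (fun y => c * f y) x = c * avg f x.
Proof. by rewrite /avg -big_distrr /= mulrCA. Qed.

Lemma avg_cst c x : (0 < degree e x)%N -> avg (fun=> c) x = c.
Proof.
move=> dx; have d0 : (degree e x)%:R != 0 :> R by rewrite pnatr_eq0 -lt0n.
apply: (mulfI d0); rewrite avgE big_const_seq count_predT iter_addr_0.
by rewrite mulr_natl.
Qed.

Lemma degree_nb x y : e x y -> (0 < degree e y)%N.
Proof.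
rewrite e_sym -in_nb => xy; rewrite lt0n; apply/eqP => /cardfs0_eq d0.
by rewrite /nb d0 in xy.
Qed.

Lemma iter_avgS n f x : iter n.+1 avg f x = avg (iter n avg f) x.
Proof. by []. Qed.

Lemma iter_avgD n f g x :
  iter n avg (fun y => f y + g y) x = iter n avg f x + iter n avg g x.
Proof.
elim: n x => [//|n IHn] x; rewrite !iter_avgS -avgD.
by apply: eq_avg => y _; apply: IHn.
Qed.

Lemma iter_avgZ n c f x : iter n avg (fun y => c * f y) x = c * iter n avg f x.
Proof.
elim: n x => [//|n IHn] x; rewrite !iter_avgS -avgZ.
by apply: eq_avg => y _; apply: IHn.
Qed.

Lemma iter_avg_cst n c x : (0 < degree e x)%N -> iter n avg (fun=> c) x = c.
Proof.
elim: n x => [//|n IHn] x dx; rewrite iter_avgS -[RHS](avg_cst c dx).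
by apply: eq_avg => y /degree_nb; apply: IHn.
Qed.

Lemma iter_avgSr n f x : iter n.+1 avg f x = iter n avg (avg f) x.
Proof. by rewrite iterSr. Qed.

(** Only the points that the walk can reach matter; [I] relates the number of
    steps left to the position. *)
Lemma iter_avg_le (I : nat -> V -> Prop) n f g x :
    (forall k y z, I k.+1 y -> e y z -> I k z) ->
    I n x -> (forall y, I 0%N y -> f y <= g y) ->
  iter n avg f x <= iter n avg g x.
Proof.
move=> I_e Ix fg; elim: n x Ix => [|n IHn] x Ix; first exact: fg.
by rewrite !iter_avgS; apply: avg_le => y /(I_e _ _ _ Ix); apply: IHn.
Qed.

Lemma iter_avg_mono n f g x :
  (forall y, f y <= g y) -> iter n avg f x <= iter n avg g x.
Proof. by move=> fg; apply: (iter_avg_le (I := fun _ _ => True)). Qed.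

Lemma eq_iter_avg n f g x : f =1 g -> iter n avg f x = iter n avg g x.
Proof. by move=> /funext ->. Qed.

Lemma iter_avg_ge0 n f x :
  (forall y, 0 <= f y) -> 0 <= iter n avg f x.
Proof.
move=> f0; elim: n x => [//|n IHn] x; rewrite iter_avgS /avg.
by rewrite mulr_ge0 ?invr_ge0 // sumr_ge0.
Qed.

Lemma iter_avg_sum (I : Type) (s : seq I) n (f : I -> V -> R) x :
  iter n avg (fun y => \sum_(i <- s) f i y) x = \sum_(i <- s) iter n avg (f i) x.
Proof.
elim: s => [|i s IHs].
  rewrite big_nil -[RHS](mul0r (iter n avg (fun=> 0) x)) -iter_avgZ.
  by apply: eq_iter_avg => y; rewrite big_nil mul0r.
rewrite big_cons -IHs -iter_avgD; apply: eq_iter_avg => y.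
by rewrite big_cons.
Qed.

(** Summing the increments of the mean of [f] expresses its growth through the
    drift of [f]. *)
Lemma iter_avg_drift n f x :
  iter n avg f x = f x + \sum_(k < n) iter k avg (fun y => avg f y - f y) x.
Proof.
elim: n => [|n IHn]; first by rewrite big_ord0 addr0.
rewrite big_ord_recr /= addrA -IHn iter_avgD -iter_avgSr.
rewrite (_ : iter n avg (fun y => - f y) x = - iter n avg f x).
  by rewrite /=; ring.
rewrite -mulN1r -iter_avgZ; apply: eq_iter_avg => y; by rewrite mulN1r.
Qed.

(** The probability that the walk from [x] is at [u] at time [n].  The target
    comes first because the operator [avg] acts on the starting point. *)
Definition hitp (n : nat) (u x : V) : R :=
  iter n avg (fun y => (y == u)%:R) x.

Lemma hitp_ge0 n u x : 0 <= hitp n u x.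
Proof. exact: iter_avg_ge0. Qed.

Fixpoint reach (u : V) (n : nat) : {fset V} :=
  (if n is n'.+1 then reach u n' `|` \bigcup_(x <- reach u n') nb x
   else [fset u])%fset.

Lemma reach_sub u n x : x \in reach u n -> x \in reach u n.+1.
Proof. by move=> xB /=; rewrite in_fsetU xB. Qed.

Lemma reach_nb u n x y : x \in reach u n -> e x y -> y \in reach u n.+1.
Proof.
move=> xB xy; rewrite /= in_fsetU; apply/orP; right.
by apply/bigfcupP; exists x; rewrite ?andbT // in_nb.
Qed.

Lemma reach_le u m n x : (m <= n)%N -> x \in reach u m -> x \in reach u n.
Proof.
by move=> /subnKC <-; elim: (n - m)%N => [|k IHk] xB;
  rewrite ?addn0 // addnS; apply/reach_sub/IHk.
Qed.

Lemma hitp_supp n u x : hitp n u x != 0 -> x \in reach u n.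
Proof.
elim: n x => [|n IHn] x.
  by rewrite /hitp /= in_fset1; case: (x == u); rewrite ?eqxx.
rewrite /hitp iter_avgS => nz.
have [/existsP|] := boolP [exists y : nb x, hitp n u (val y) != 0].
  move=> [[y /= yx] /IHn yB]; rewrite in_nb e_sym in yx.
  exact: reach_nb yB yx.
move=> /existsPn z; case/eqP: nz.
rewrite /avg big_seq big1 ?mulr0 // => y yx.
by have := z [` yx]; rewrite negbK => /eqP.
Qed.

End Averaging.

Arguments hitp : simpl never.

(** * Reversibility and the Dirichlet form *)

Section Energy.
Context {R : realType} {V : choiceType} (e : rel V).
Hypothesis e_sym : symmetric e.
Hypothesis e_fin : forall v, finite_set (nbhd e v).

Local Notation deg x := ((degree e x)%:R : R).

(** Sums over neighbourhoods become sums over one fixed finite set, where the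
    order of summation can be exchanged. *)
Lemma sum_nb (S : {fset V}) (f : V -> R) x :
    (forall y, e x y -> f y != 0 -> y \in S) ->
  \sum_(y <- nb e x) f y = \sum_(y <- S) (e x y)%:R * f y.
Proof.
move=> fS; rewrite (bigID (fun y => f y != 0)) /= [X in _ + X]big1 ?addr0; last first.
  by move=> y /negPn/eqP.
rewrite [RHS](bigID (fun y => e x y && (f y != 0))) /=.
rewrite [X in _ = _ + X]big1 ?addr0; last first.
  by move=> y; rewrite negb_and negbK => /orP[/negPf->|/eqP->]; rewrite ?mul0r ?mulr0.
under [RHS]eq_bigr => y /andP[-> _] do rewrite mul1r.
rewrite -big_filter -[RHS]big_filter; apply/perm_big/uniq_perm.
- exact/filter_uniq/fset_uniq.
- exact/filter_uniq/fset_uniq.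
move=> y; rewrite !mem_filter in_nb //; have [exy|//] := boolP (e x y); last by rewrite andbF.
by case: eqVneq => //= fy; rewrite fS.
Qed.

(** [inside S f]: the support of [f] and its neighbours lie in [S], so that sums
    over [S] see all the edges where [f] varies. *)
Definition inside (S : {fset V}) (f : V -> R) : Prop :=
  forall x, f x != 0 -> x \in S /\ forall y, e x y -> y \in S.

Definition dot (S : {fset V}) (f h : V -> R) : R :=
  \sum_(x <- S) deg x * f x * h x.

Lemma dotDD S f1 f2 g1 g2 :
  dot S (fun x => f1 x + f2 x) (fun x => g1 x + g2 x) =
  dot S f1 g1 + dot S f1 g2 + (dot S f2 g1 + dot S f2 g2).
Proof. by rewrite /dot -!big_split; apply: eq_bigr => x _ /=; ring. Qed.

Lemma dotBB S f1 f2 g1 g2 :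
  dot S (fun x => f1 x - f2 x) (fun x => g1 x - g2 x) =
  dot S f1 g1 - dot S f1 g2 - (dot S f2 g1 - dot S f2 g2).
Proof. by rewrite /dot -!sumrB; apply: eq_bigr => x _ /=; ring. Qed.

Lemma avg_adjoint S f h : inside S f -> dot S (avg e f) h = dot S f (avg e h).
Proof.
move=> fS; rewrite /dot.
under eq_bigr => x _.
  rewrite avgE (sum_nb (S := S)) => [|y _ /fS[]//]; rewrite big_distrl /=.
  over.
rewrite exchange_big /=; apply: eq_bigr => y _.
rewrite mulrAC avgE big_distrl /=.
have [->|fy] := eqVneq (f y) 0.
  rewrite !big1 // => x _; by rewrite ?mulr0 ?mul0r.
rewrite (sum_nb (S := S)) => [|x yx _]; last by have [_ ->] := fS _ fy.
by apply: eq_bigr => x _; rewrite e_sym; ring.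
Qed.

Lemma inside_hitp u n m : (n < m)%N -> inside (reach e u m) (hitp e n u).
Proof.
move=> nm x /(hitp_supp e_sym e_fin) xB; split=> [|y xy].
  exact: reach_le (ltnW nm) xB.
exact: reach_le nm (reach_nb e_fin xB xy).
Qed.

(** Reversibility: the transition probabilities towards [u], weighted by the
    degree, are the law of the walk started at [u]. *)
Lemma hitp_law u n m h : (n <= m)%N ->
  dot (reach e u m) (hitp e n u) h = deg u * iter n (avg e) h u.
Proof.
elim: n h => [|n IHn] h nm.
  rewrite /dot (big_fsetD1 u) /=; last by rewrite (reach_le (leq0n m)) //= in_fset1.
  rewrite big_seq big1 ?addr0 => [|x]; first by rewrite /hitp /= eqxx mulr1.
  by rewrite in_fsetD1 => /andP[/negPf xu _]; rewrite /hitp /= xu mulr0 mul0r.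
rewrite (_ : hitp e n.+1 u = avg e (hitp e n u)) // avg_adjoint; last exact: inside_hitp.
by rewrite IHn ?(ltnW nm) // -iterSr.
Qed.

Lemma hitp_dot u n k m : (n <= m)%N ->
  dot (reach e u m) (hitp e n u) (hitp e k u) = deg u * hitp e (n + k) u u.
Proof. by move=> nm; rewrite hitp_law // /hitp iterD. Qed.

Lemma hitp_sym n u x : deg u * hitp e n x u = deg x * hitp e n u x.
Proof.
rewrite -(hitp_law _ _ (leqnn n)) // /dot.
have [xB|xB] := boolP (x \in reach e u n); last first.
  rewrite big_seq big1 => [|y yB].
    by have := contraNeq (@hitp_supp R _ _ e_sym e_fin n u x); move=> /(_ xB) ->; rewrite mulr0.
  have [yx|_] := eqVneq y x; last by rewrite mulr0.
  by rewrite yx (negPf xB) in yB.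
rewrite (big_fsetD1 x) //= eqxx mulr1 big_seq big1 ?addr0 // => y.
by rewrite in_fsetD1 => /andP[/negPf -> _]; rewrite mulr0.
Qed.

(** The Dirichlet form ([c = -1]) and its signless version ([c = 1]). *)
Definition edge_form (c : R) (S : {fset V}) (f : V -> R) : R :=
  \sum_(x <- S) \sum_(y <- S) (e x y)%:R * (f x + c * f y) ^+ 2.

Lemma edge_formE c S f : c ^+ 2 = 1 -> inside S f ->
  edge_form c S f = 2 * (dot S f f + c * dot S f (avg e f)).
Proof.
move=> c2 fS.
have diag : \sum_(x <- S) \sum_(y <- S) (e x y)%:R * f x ^+ 2 = dot S f f.
  apply: eq_bigr => x _; have [->|fx] := eqVneq (f x) 0.
    by rewrite mulr0 big1 // => y _; rewrite expr2 mulr0 mulr0.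
  rewrite -big_distrl /= (_ : \sum_(y <- S) (e x y)%:R = deg x); first by ring.
  under eq_bigr do rewrite -[(_)%:R]mulr1.
  rewrite -(@sum_nb S (fun=> 1)) => [|y xy _]; last by have [_ ->] := fS _ fx.
  by rewrite big_const_seq count_predT iter_addr_0.
have cross : \sum_(x <- S) \sum_(y <- S) (e x y)%:R * (f x * f y) = dot S f (avg e f).
  apply: eq_bigr => x _; rewrite mulrAC avgE (sum_nb (S := S)) => [|y _ /fS[]//].
  by rewrite big_distrl /=; apply: eq_bigr => y _; ring.
rewrite /edge_form.
transitivity (\sum_(x <- S) \sum_(y <- S) ((e x y)%:R * f x ^+ 2
    + c ^+ 2 * ((e y x)%:R * f y ^+ 2) + (2 * c) * ((e x y)%:R * (f x * f y)))).
  by apply: eq_bigr => x _; apply: eq_bigr => y _; rewrite (e_sym y x); ring.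
under eq_bigr => x _ do rewrite !big_split /= -!big_distrr /=.
rewrite !big_split /= -!big_distrr /= diag cross c2 mul1r.
by rewrite [X in _ + X + _]exchange_big /= diag; ring.
Qed.

Lemma edge_form_ge0 c S f : 0 <= edge_form c S f.
Proof. by do 2!apply: sumr_ge0 => ? _; rewrite mulr_ge0 ?sqr_ge0. Qed.

(** On a bipartite graph the walk alternates between the two classes.  Adding the
    probabilities of two successive times removes this oscillation, and makes the
    Dirichlet form below control the decay of return probabilities. *)
Definition hit2 (n : nat) (u x : V) : R := hitp e n u x + hitp e n.+1 u x.

Lemma hit2_ge0 n u x : 0 <= hit2 n u x.
Proof. by rewrite addr_ge0 ?hitp_ge0. Qed.

Lemma inside_hit2 u n m : (n.+1 < m)%N -> inside (reach e u m) (hit2 n u).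
Proof.
move=> nm x; have [h0|h0 _] := eqVneq (hitp e n u x : R) 0.
  by rewrite /hit2 h0 add0r; apply: inside_hitp.
exact: inside_hitp (ltnW nm) _ h0.
Qed.

(** The Dirichlet form of [hit2 n u] is the rate of decay of the probability of
    return at time [2 n]. *)
Lemma hit2_energy u n m : (n.+1 < m)%N ->
  edge_form (-1) (reach e u m) (hit2 n u) =
  2 * (deg u * (hit2 n.*2 u u - hit2 n.*2.+2 u u)).
Proof.
move=> nm; have [n0 n1] : (n <= m)%N /\ (n.+1 <= m)%N by split; lia.
rewrite edge_formE; [|by rewrite sqrrN expr1n|exact: inside_hit2].
rewrite (_ : avg e (hit2 n u) = hit2 n.+1 u); last by apply/funext => x; exact: avgD.
rewrite !dotDD !hitp_dot // /hit2 !(addnS, addSn) addnn; ring.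
Qed.

(** The decay of return probabilities slows down: the second difference is the
    signless form of [hitp e n u - hitp e n.+2 u]. *)
Lemma hit2_convex u n :
  hit2 n.*2.+2 u u - hit2 n.*2.+4 u u <= hit2 n.*2 u u - hit2 n.*2.+2 u u.
Proof.
have [d0|d0] := posnP (degree e u).
  have z k : hitp e k.+1 u u = 0.
    by rewrite /hitp /= /avg d0 invr0 mul0r.
  rewrite /hit2 !z; have := hitp_ge0 e n.*2 u u : 0 <= _ :> R; lra.
pose m := n.+4; pose w x : R := hitp e n u x - hitp e n.+2 u x.
have wm : inside (reach e u m) w.
  move=> x; have [h0|h0 _] := eqVneq (hitp e n u x : R) 0.
    by rewrite /w h0 sub0r oppr_eq0; apply: inside_hitp.
  by apply: inside_hitp h0; rewrite /m ltnS leqW // leqW.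
have := edge_form_ge0 1 (reach e u m) w.
rewrite edge_formE ?expr1n // mul1r.
rewrite (_ : avg e w = fun x => hitp e n.+1 u x - hitp e n.+3 u x); last first.
  apply/funext => x; rewrite /w avgD; congr (_ + _).
  rewrite -mulN1r -avgZ; congr avg; apply/funext => y; by rewrite mulN1r.
rewrite !dotBB !hitp_dot ?/m //; try lia.
rewrite !(addnS, addSn) addnn pmulr_rge0 // => H.
have d1 : 0 < deg u by rewrite ltr0n.
rewrite -(ler_pM2l d1) /hit2; move: H; lra.
Qed.

End Energy.

(** * Upper bounds for return probabilities *)

Lemma ler_sum_support (R : realType) (I : eqType) (s s' : seq I) (F : I -> R) :
    uniq s -> uniq s' -> (forall x, 0 <= F x) ->
    (forall x, x \in s -> F x != 0 -> x \in s') ->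
  \sum_(x <- s) F x <= \sum_(x <- s') F x.
Proof.
move=> us us' F0 ss'.
rewrite (bigID (fun x => F x != 0)) /= [X in _ + X]big1 ?addr0; last first.
  by move=> x /negPn/eqP.
rewrite [leRHS](bigID (fun x => (F x != 0) && (x \in s))) /=.
rewrite -big_filter -[in leRHS]big_filter.
rewrite (perm_big [seq x <- s' | (F x != 0) && (x \in s)]) ?lerDl ?sumr_ge0 //=.
apply: uniq_perm; rewrite ?filter_uniq // => x; rewrite !mem_filter.
case: (eqVneq (F x) 0) => //= Fx; have [xs|//] := boolP (x \in s).
by rewrite ss'.
Qed.

Section ReturnProbability.
Context {R : realType} {V : choiceType} (e : rel V).
Hypothesis e_sym : symmetric e.
Hypothesis e_fin : forall v, finite_set (nbhd e v).

Local Notation deg x := ((degree e x)%:R : R).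

Definition dist_le (r : nat) (x y : V) : Prop :=
  exists p, [/\ path e x p, last x p = y & (size p <= r)%N].

(** Cauchy-Schwarz for the telescoping sum of [f] along a path. *)
Lemma path_gradient (f : V -> R) x p :
  (f x - f (last x p)) ^+ 2 <=
  (size p)%:R * \sum_(z <- zip (x :: p) p) (f z.1 - f z.2) ^+ 2.
Proof.
elim: p x => [|y p IHp] x /=; first by rewrite subrr expr0n mul0r.
rewrite big_cons /=; have := IHp y.
set q := \sum_(z <- _) _; have q0 : 0 <= q by apply: sumr_ge0 => z _; apply: sqr_ge0.
rewrite (_ : f x - f (last y p) = (f x - f y) + (f y - f (last y p))); last by ring.
move: (f x - f y) (f y - _) => a b; rewrite -natr1.
have [->|] := posnP (size p).
  rewrite mul0r => b0; have -> : b = 0 by apply/eqP; rewrite -sqrf_eq0 eq_le b0 sqr_ge0.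
  by rewrite addr0 add0r mul1r lerDl.
move=> p0; have : 0 < (size p)%:R :> R by rewrite ltr0n.
move: (size p)%:R => n n0 bq; rewrite -subr_ge0 -(pmulr_rge0 _ n0).
have : 0 <= (n * a - b) ^+ 2 by exact: sqr_ge0.
have : n * b ^+ 2 <= n * (n * q) by rewrite ler_pM2l.
nra.
Qed.

(** A path without repeated vertices uses each edge once: the sum over its edges is
    bounded by the whole Dirichlet form. *)
Lemma dist_le_gradient (S : {fset V}) (f : V -> R) r x y :
    inside e S f -> dist_le r x y ->
  (f x - f y) ^+ 2 <= r%:R * edge_form e (-1) S f.
Proof.
move=> fS [p [xp <-]]; case/shortenP: xp => p' xp' up' sub_p' szr.
have {}szr : (size p' <= r)%N.
  apply: leq_trans szr; apply: uniq_leq_size => //; by case/andP: up'.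
apply: le_trans (path_gradient f x p') _.
apply: ler_pM => //; first by apply: sumr_ge0 => z _; apply: sqr_ge0.
  by rewrite ler_nat.
have adj z : z \in zip (x :: p') p' -> e z.1 z.2.
  elim: p' x xp' {up' sub_p' szr} => [//|b p' IHp'] a /= /andP[ab bp'].
  by rewrite in_cons => /orP[/eqP->//|]; apply: IHp'.
pose G z : R := (e z.1 z.2)%:R * (f z.1 + -1 * f z.2) ^+ 2.
have -> : edge_form e (-1) S f = \sum_(z <- [seq (a, b) | a <- S, b <- S]) G z.
  by rewrite big_allpairs.
rewrite big_seq (eq_bigr G) => [|z /adj zz]; last by rewrite /G zz mul1r mulN1r.
rewrite -big_seq.
apply: ler_sum_support.
- apply: (@map_uniq _ _ snd); rewrite -/(unzip2 _) unzip2_zip //.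
  by case/andP: up'.
- apply: allpairs_uniq; rewrite ?fset_uniq //.
  by move=> [a b] [c d] _ _ /= [-> ->].
- by move=> z; rewrite mulr_ge0 ?sqr_ge0.
move=> [a b] /adj /= ab nz; apply/allpairsP; exists (a, b) => /=; split => //.
  have [fa|/fS[]//] := eqVneq (f a) 0.
  have [fb|/fS[_ ->//]] := eqVneq (f b) 0; last by rewrite e_sym.
  by move: nz; rewrite /G /= fa fb mulr0 addr0 expr0n mulr0 eqxx.
have [fb|/fS[]//] := eqVneq (f b) 0.
have [fa|/fS[_ ->//]] := eqVneq (f a) 0.
by move: nz; rewrite /G /= fa fb mulr0 addr0 expr0n mulr0 eqxx.
Qed.

(** The decrements of the return probabilities are nonincreasing, so each is
    bounded by the mean of the [t.+1] decrements that precede it. *)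
Lemma hit2_energy_le u t m : (t.*2.+1 < m)%N ->
  t.+1%:R * edge_form e (-1) (reach e u m) (hit2 e t.*2 u) <=
  2 * (deg u * hit2 e t.*2 u u).
Proof.
move=> tm; rewrite hit2_energy // mulrCA ler_pM2l ?ltr0n // mulrCA ler_wpM2l //.
pose D k : R := hit2 e k.*2 u u - hit2 e k.*2.+2 u u.
have Dle k i : D (k + i)%N <= D k.
  elim: i => [|i IHi]; first by rewrite addn0.
  by rewrite addnS; apply: le_trans IHi; rewrite /D doubleS; apply: hit2_convex.
have tel k : \sum_(i < k) D (t + i)%N = hit2 e t.*2 u u - hit2 e (t + k).*2 u u.
  elim: k => [|k IHk]; first by rewrite big_ord0 addn0 subrr.
  by rewrite big_ord_recr /= IHk addnS doubleS /D; ring.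
have : \sum_(i < t.+1) D t.*2 <= \sum_(i < t.+1) D (t + i)%N.
  apply: ler_sum => i _; rewrite -addnn.
  have -> : (t + t = t + i + (t - i))%N by have := ltn_ord i; lia.
  exact: Dle.
rewrite tel sumr_const card_ord -[D _ *+ _]mulr_natl => /le_trans; apply.
by rewrite gerBl hit2_ge0.
Qed.

Lemma sum_hit2 n u m : (0 < degree e u)%N -> (n < m)%N ->
  \sum_(x <- reach e u m) deg x * hit2 e n u x = 2 * deg u.
Proof.
move=> du nm.
transitivity (dot e (reach e u m) (hitp e n u) (fun=> 1) +
              dot e (reach e u m) (hitp e n.+1 u) (fun=> 1) : R).
  by rewrite /dot -big_split; apply: eq_bigr => x _; rewrite /hit2 /=; ring.
by rewrite !hitp_law ?(ltnW nm) // !iter_avg_cst //; ring.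
Qed.

(** A lower bound for the number [size B] of points within distance [r] bounds
    return probabilities: some point of [B] is visited with probability at most
    [C / size B], and the Dirichlet form at time [t] is too small for the
    probabilities at [u] and at that point to differ much. *)
Lemma return_le (D r t : nat) (B : seq V) u :
    (forall v, degree e v <= D)%N -> (0 < degree e u)%N ->
    uniq B -> (0 < size B)%N ->
    (forall x, x \in B -> dist_le r u x) -> (forall x, x \in B -> (0 < degree e x)%N) ->
    (4 * D * r * size B <= t)%N ->
  hit2 e t.*2 u u <= 4 * D%:R / (size B)%:R :> R.
Proof.
move=> eD du uB B0 Bnear Bdeg tB.
pose g := hit2 e t.*2 u : V -> R; set b := (size B)%:R : R.
have b0 : 0 < b by rewrite ltr0n.
have D1 : 1 <= D%:R :> R by rewrite ler1n (leq_trans du).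
have duD : deg u <= D%:R by rewrite ler_nat.
have [x xB gx] : exists2 x, x \in B & g x <= 2 * D%:R / b.
  apply: contrapT => /forall2NP H.
  have gc x : x \in B -> 2 * D%:R / b < g x.
    by move=> xB; rewrite ltNge; apply/negP; case: (H x).
  have : b * (2 * D%:R / b) < \sum_(x <- B) g x.
    rewrite (_ : b * _ = \sum_(x <- B) (2 * D%:R / b)); last first.
      by rewrite big_const_seq count_predT iter_addr_0 -[RHS]mulr_natl.
    move: gc; move: (_ / _) => c; case: (B) B0 => // y B' _ gc.
    rewrite !big_cons ltr_leD ?gc ?mem_head // big_seq [leRHS]big_seq.
    by apply: ler_sum => z zB; rewrite ltW // gc // in_cons zB orbT.
  rewrite mulrC divfK ?gt_eqF // ltNge; apply/negP; rewrite negbK.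
  apply: (@le_trans _ _ (2 * deg u)); last by rewrite ler_pM2l.
  rewrite -(sum_hit2 du (ltnSn t.*2)).
  apply: (@le_trans _ _ (\sum_(x <- B) deg x * g x)).
    rewrite big_seq [leRHS]big_seq; apply: ler_sum => x xB.
    by rewrite ler_peMl ?hit2_ge0 // ler1n Bdeg.
  apply: ler_sum_support => //.
    by move=> x; rewrite mulr_ge0 ?hit2_ge0.
  move=> x _; have [h0|/(hitp_supp e_sym e_fin) h _] := eqVneq (hitp e t.*2 u x : R) 0.
    rewrite /g /hit2 h0 add0r mulf_eq0 negb_or => /andP[_].
    exact: hitp_supp.
  exact: reach_sub.
have := dist_le_gradient (inside_hit2 e_sym e_fin (u := u) (ltnSn t.*2.+1)) (Bnear x xB).
have := hit2_energy_le u (ltnSn t.*2.+1).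
set E := edge_form _ _ _ _; have E0 : 0 <= E by exact: edge_form_ge0.
rewrite -/g; set a := g u => tE aE; rewrite leNgt; apply/negP.
rewrite ltr_pdivrMr // => ab; move: gx; rewrite ler_pdivlMr // => gx.
have a0 : 0 < a by rewrite -(pmulr_lgt0 _ b0); apply: le_lt_trans ab; rewrite mulr_ge0.
have half : a / 2 < a - g x by rewrite -(ltr_pM2r b0); lra.
have aE' : a ^+ 2 / 4 < r%:R * E.
  apply: lt_le_trans aE; rewrite (_ : a ^+ 2 / 4 = (a / 2) ^+ 2); last by field.
  by rewrite ltr_pXn2r ?nnegrE //; lra.
have tD : 2 * (deg u * a) <= 2 * D%:R * a by rewrite -mulrA ler_pM2l // ler_pM2r.
have tr : 4 * D%:R * r%:R * b < t.+1%:R by rewrite -!natrM ltr_nat.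
have r0 : 0 <= r%:R :> R by [].
have T0 : 0 < t.+1%:R :> R by rewrite ltr0n.
have h1 : t.+1%:R * (a ^+ 2 / 4) < r%:R * (2 * D%:R * a).
  apply: (@lt_le_trans _ _ (r%:R * (t.+1%:R * E))).
    by rewrite [ltRHS]mulrCA ltr_pM2l.
  by rewrite ler_wpM2l // (le_trans tE).
have h2 : t.+1%:R * a < 8 * r%:R * D%:R.
  by rewrite -(ltr_pM2r a0); move: h1; lra.
have h3 : 4 * D%:R * r%:R * b * a <= 8 * r%:R * D%:R.
  by apply: le_trans (ltW h2); rewrite ler_pM2r // ltW.
have [r_eq|r_gt] := posnP r.
  by move: aE'; rewrite r_eq mul0r; nra.
have r1 : 0 < r%:R :> R by rewrite ltr0n.
have : 4 * (D%:R * r%:R) * (b * a) <= 4 * (D%:R * r%:R) * 2 by lra.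
rewrite ler_pM2l; last by rewrite !mulr_gt0 // (lt_le_trans ltr01).
move: ab D1; lra.
Qed.
End ReturnProbability.

(** * Lower bounds and collision probabilities *)

Section Collisions.
Context {R : realType} {V : choiceType} (e : rel V).
Hypothesis e_sym : symmetric e.
Hypothesis e_fin : forall v, finite_set (nbhd e v).
Variable D : nat.
Hypothesis e_deg : forall v, (degree e v <= D)%N.

Local Notation deg x := ((degree e x)%:R : R).

Lemma degree_ub x : deg x <= D%:R. Proof. by rewrite ler_nat. Qed.

(** Cauchy-Schwarz: a walk that is likely to be in a small set [B] at time [n]
    is likely to be back at time [n + n]. *)
Lemma return_ge n (B : seq V) u :
    (0 < degree e u)%N -> uniq B -> (0 < size B)%N ->
    1 / 2 <= iter n (avg e) (fun y => (y \in B)%:R : R) u ->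
  1 / (4 * D%:R * (size B)%:R) <= hitp e (n + n) u u :> R.
Proof.
move=> du uB B0; set b := (size B)%:R : R => half.
have b0 : 0 < b by rewrite ltr0n.
have d1 : 1 <= deg u by rewrite ler1n.
have D1 : 1 <= D%:R :> R by apply: le_trans (degree_ub u).
pose S := reach e u n; pose q := hitp e n u : V -> R.
have mass : dot e S q (fun y => (y \in B)%:R) = deg u * iter n (avg e) (fun y => (y \in B)%:R) u.
  by rewrite hitp_law.
have sq : dot e S q q = deg u * hitp e (n + n) u u by rewrite hitp_dot.
pose l := deg u / (2 * D%:R * b).
have l0 : 0 < l by rewrite divr_gt0 ?mulr_gt0 // (lt_le_trans ltr01).
have cs : 2 * l * dot e S q (fun y => (y \in B)%:R) <=
    dot e S q q + l ^+ 2 * (D%:R * b).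
  apply: (@le_trans _ _ (dot e S q q + l ^+ 2 * \sum_(x <- S) deg x * (x \in B)%:R)).
    rewrite /dot !big_distrr -big_split /=; apply: ler_sum => x _.
    have : 0 <= deg x * (q x - l * (x \in B)%:R) ^+ 2 by rewrite mulr_ge0 ?sqr_ge0.
    by case: (x \in B); rewrite ?mulr1 ?mulr0 ?subr0 //; lra.
  rewrite lerD2l ler_wpM2l ?sqr_ge0 //.
  apply: (@le_trans _ _ (\sum_(x <- B) deg x * (x \in B)%:R)).
    apply: ler_sum_support => // x _.
    by case: (x \in B); rewrite ?mulr0 ?eqxx.
  rewrite [X in _ <= _ * X](_ : b = \sum_(x <- B) 1); last first.
    by rewrite big_const_seq count_predT iter_addr_0.
  rewrite big_distrr big_seq [leRHS]big_seq; apply: ler_sum => x xB.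
  by rewrite xB /= !mulr1 degree_ub.
have {}cs : l * deg u <= deg u * hitp e (n + n) u u + l ^+ 2 * (D%:R * b).
  apply: le_trans (_ : 2 * l * dot e S q (fun y => (y \in B)%:R) <= _); last by rewrite -sq.
  rewrite mass; have : 0 < l * deg u by rewrite mulr_gt0 // (lt_le_trans ltr01).
  move: half; set z := iter _ _ _ _ => half; nra.
have lE : l * (2 * D%:R * b) = deg u.
  by rewrite /l divfK // gt_eqF // !mulr_gt0 // (lt_le_trans ltr01).
have Db : 0 < 4 * D%:R * b by rewrite !mulr_gt0 // (lt_le_trans ltr01).
rewrite ler_pdivrMr //.
have {}cs : l * deg u / 2 <= deg u * hitp e (n + n) u u.
  by move: cs; rewrite -lE; set h := hitp _ _ _ _; nra.
have {}cs : l / 2 <= hitp e (n + n) u u.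
  by move: cs; rewrite mulrAC mulrC ler_pM2l // (lt_le_trans ltr01).
apply: le_trans (_ : l / 2 * (4 * D%:R * b) <= _); last by rewrite ler_pM2r.
have -> : l / 2 * (4 * D%:R * b) = l * (2 * D%:R * b) by move: (l) => y; field.
by rewrite lE.
Qed.

Lemma hit2_decr u k : (0 < degree e u)%N ->
  hit2 e k.*2.+2 u u <= hit2 e k.*2 u u :> R.
Proof.
move=> du; have := edge_form_ge0 e (-1) (reach e u k.+2) (hit2 e k u : V -> R).
rewrite hit2_energy // !pmulr_rge0 ?ltr0n // subr_ge0; exact.
Qed.

Lemma hit2_mono u k l : (0 < degree e u)%N -> (k <= l)%N ->
  hit2 e l.*2 u u <= hit2 e k.*2 u u :> R.
Proof.
move=> du /subnKC <-; elim: (l - k)%N => [|i IHi]; first by rewrite addn0.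
by rewrite addnS doubleS; apply: le_trans IHi; apply: hit2_decr.
Qed.

(** Near-diagonal lower bound: by the decay of the Dirichlet form, the lower bound
    at [u] persists at distance [r] from [u]. *)
Lemma hit2_ge (b r t : nat) u x :
    (0 < degree e u)%N -> (0 < b)%N -> dist_le e r u x ->
    1 / (4 * D%:R * b%:R) <= hitp e t.*2 u u :> R ->
    (32 * D ^ 2 * b * r <= t)%N ->
  1 / (8 * D%:R * b%:R) <= hit2 e t.*2 u x :> R.
Proof.
move=> du b0 ux; have D0 : 0 < D%:R :> R by rewrite ltr0n (leq_trans du).
have {}b0 : 0 < b%:R :> R by rewrite ltr0n.
have Db : 0 < D%:R * b%:R :> R by exact: mulr_gt0.
move=> lo tr.
have := dist_le_gradient e_sym (inside_hit2 (R := R) e_sym e_fin (u := u) (ltnSn t.*2.+1)) ux.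
have := hit2_energy_le (R := R) e_sym e_fin u (ltnSn t.*2.+1).
set E := edge_form _ _ _ _; set a : R := hit2 e t.*2 u u; set c : R := hit2 e _ u x.
have E0 : 0 <= E by exact: edge_form_ge0.
have {}lo : 1 / (4 * D%:R * b%:R) <= a.
  by apply: le_trans lo _; rewrite /a /hit2 lerDl hitp_ge0.
have a0 : 0 < a by apply: lt_le_trans lo; rewrite divr_gt0 // !mulr_gt0.
have aDb : 1 <= a * (4 * D%:R * b%:R).
  by rewrite -ler_pdivrMr // !mulr_gt0.
have T : 32 * (D%:R * D%:R) * b%:R * r%:R < t.+1%:R :> R.
  by rewrite -!natrM ltr_nat ltnS mulnn.
have T0 : 0 < t.+1%:R :> R by rewrite ltr0n.
have duD : deg u * a <= D%:R * a by rewrite ler_pM2r // degree_ub.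
move: T T0; set T := t.+1%:R; set rr := r%:R : R => TD T0 tE aE.
have rr0 : 0 <= rr by exact: ler0n.
(* r E <= 2 D r a / T <= a / (16 D b) <= (a / 2) ^ 2 *)
have key : rr * E <= a ^+ 2 / 4.
  rewrite -(ler_pM2l T0) mulrCA.
  apply: (@le_trans _ _ (rr * (2 * (D%:R * a)))).
    by rewrite ler_wpM2l // (le_trans tE) // ler_pM2l.
  apply: (@le_trans _ _ (rr * (2 * (D%:R * a)) * (a * (4 * D%:R * b%:R)))).
    by rewrite ler_peMr // !mulr_ge0 // ltW.
  rewrite (_ : _ * _ = (32 * (D%:R * D%:R) * b%:R * rr) * (a ^+ 2 / 4)); last by field.
  by rewrite ler_pM2r ?(ltW TD) // divr_gt0 // exprn_gt0.
have ca : a / 2 <= c.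
  rewrite leNgt; apply/negP => ca.
  have : (a / 2) ^+ 2 < (a - c) ^+ 2 by rewrite ltr_pXn2r ?nnegrE //; lra.
  by move: aE key; lra.
apply: le_trans ca.
rewrite (_ : 1 / (8 * D%:R * b%:R) = 1 / (4 * D%:R * b%:R) / 2); last first.
  by field; rewrite ?gt_eqF.
by rewrite ler_pM2r.
Qed.

(** The probability that independent walks from [u], [v] and [w] meet at time [n],
    as the mean of a function of the position of the first one. *)
Definition coll (n : nat) (u v w : V) : R :=
  iter n (avg e) (fun x => hitp e n x v * hitp e n x w) u.

Lemma coll_ge0 n u v w : 0 <= coll n u v w.
Proof. by apply: iter_avg_ge0 => x; rewrite mulr_ge0 ?hitp_ge0. Qed.

Lemma coll_ge n u v w (T : seq V) : uniq T ->
  \sum_(y <- T) hitp e n y u * hitp e n y v * hitp e n y w <= coll n u v w.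
Proof.
move=> uT.
rewrite (_ : \sum_(y <- T) _ =
  iter n (avg e) (fun x => \sum_(y <- T) (hitp e n y v * hitp e n y w) * (x == y)%:R) u).
  apply: iter_avg_mono => // x.
  have [xT|xT] := boolP (x \in T); last first.
    rewrite big_seq big1 ?mulr_ge0 ?hitp_ge0 // => y yT.
    by case: eqP => [xy|]; rewrite ?mulr0 // -xy (negPf xT) in yT *.
  rewrite (bigD1_seq x) //= eqxx mulr1 big1 ?addr0 // => y /negPf.
  by rewrite eq_sym => ->; rewrite mulr0.
rewrite iter_avg_sum //; apply: eq_bigr => y _.
by rewrite iter_avgZ // -/(hitp e n y u); ring.
Qed.

Lemma hitp_rev_ge n u x : (0 < degree e u)%N -> (0 < degree e x)%N ->
  hitp e n u x / D%:R <= hitp e n x u :> R.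
Proof.
move=> du dx; have D0 : 0 < D%:R :> R by rewrite ltr0n (leq_trans du).
rewrite ler_pdivrMr // mulrC.
apply: (@le_trans _ _ (deg x * hitp e n u x)).
  by rewrite ler_peMl ?hitp_ge0 // ler1n.
by rewrite -hitp_sym // ler_wpM2r ?hitp_ge0 // degree_ub.
Qed.

Variable col : V -> bool.
Hypothesis e_col : forall x y, e x y -> col y = ~~ col x.

Lemma hitp_col n u x : col x != col u (+) odd n -> hitp e n u x = 0 :> R.
Proof.
elim: n x => [|n IHn] x.
  by rewrite /hitp /= addbF; case: (eqVneq x u) => [->|//]; rewrite eqxx.
move=> cx; rewrite /hitp iter_avgS /avg big_seq big1 ?mulr0 // => y.
rewrite in_nb // => /e_col cy; apply: IHn; move: cx; rewrite cy /=.
by case: (col x); case: (col u); case: (odd n).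
Qed.

(** Two successive times: at each [x] exactly one of them has the parity for
    which the walks, started in the same class, can be at [x]. *)
Lemma coll2_ge n u v w (T : seq V) :
    (0 < degree e u)%N -> (0 < degree e v)%N -> (0 < degree e w)%N ->
    col v = col u -> col w = col u -> uniq T ->
    (forall x, x \in T -> (0 < degree e x)%N) ->
  (\sum_(x <- T) hit2 e n u x * hit2 e n v x * hit2 e n w x) / D%:R ^+ 3 <=
  coll n u v w + coll n.+1 u v w.
Proof.
move=> du dv dw cv cw uT dT.
have D0 : 0 < D%:R :> R by rewrite ltr0n (leq_trans du).
apply: le_trans (lerD (coll_ge n u v w uT) (coll_ge n.+1 u v w uT)).
rewrite big_distrl -big_split /= big_seq [leRHS]big_seq.
have step m x : x \in T ->
    hitp e m u x * hitp e m v x * hitp e m w x / D%:R ^+ 3 <=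
    hitp e m x u * hitp e m x v * hitp e m x w :> R.
  move=> /dT dx; rewrite (_ : _ / _ = hitp e m u x / D%:R * (hitp e m v x / D%:R) *
    (hitp e m w x / D%:R)); last by field; rewrite gt_eqF.
  by rewrite !ler_pM ?mulr_ge0 ?invr_ge0 ?hitp_ge0 ?hitp_rev_ge // ltW.
apply: ler_sum => x xT; have [cx|cx] := eqVneq (col x) (col u (+) odd n).
  have z y : col y = col u -> hitp e n.+1 y x = 0 :> R.
    by move=> cy; apply: hitp_col; rewrite cx cy /=; case: (col u); case: (odd n).
  rewrite /hit2 !z // !addr0; apply: le_trans (step n x xT) _.
  by rewrite lerDl; rewrite mulr_ge0 ?hitp_ge0 ?(mulr_ge0 (hitp_ge0 _ _ _ _)) ?hitp_ge0.
have z y : col y = col u -> hitp e n y x = 0 :> R.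
  by move=> cy; apply: hitp_col; rewrite cy.
rewrite /hit2 !z // !add0r; apply: le_trans (step n.+1 x xT) _.
by rewrite lerDr; rewrite mulr_ge0 ?hitp_ge0 ?(mulr_ge0 (hitp_ge0 _ _ _ _)) ?hitp_ge0.
Qed.

(** The walk from [v] and the reversed walk from [x] meet halfway; the product of
    their transition probabilities is bounded by half the sum of the squares,
    which leaves return probabilities only. *)
Lemma hitp2_le s v x : (0 < degree e v)%N ->
  hitp e (s + s) x v <= D%:R / 2 * (hitp e (s + s) v v + hitp e (s + s) x x) :> R.
Proof.
move=> dv.
apply: (@le_trans _ _ (deg v * hitp e (s + s) x v)).
  by rewrite ler_peMl ?hitp_ge0 // ler1n.
rewrite (_ : hitp e (s + s) x v = iter s (avg e) (hitp e s x) v); last first.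
  by rewrite /hitp iterD.
rewrite -(hitp_law e_sym e_fin _ _ (leqnn s)).
pose q := hitp e s v : V -> R; pose p := hitp e s x : V -> R.
have : dot e (reach e v s) p p <= dot e (reach e x s) p p.
  apply: ler_sum_support; rewrite ?fset_uniq // => y.
    by rewrite -mulrA mulr_ge0 // mulr_ge0 ?hitp_ge0.
  by move=> _; rewrite mulf_eq0 negb_or => /andP[_]; apply: hitp_supp.
rewrite hitp_dot // => pp; have qq := hitp_dot (R := R) e_sym e_fin v s (leqnn s).
have pq : 2 * dot e (reach e v s) q p <= dot e (reach e v s) q q + dot e (reach e v s) p p.
  rewrite /dot big_distrr -big_split /=; apply: ler_sum => y _.
  have : 0 <= deg y * (q y - p y) ^+ 2 by rewrite mulr_ge0 ?sqr_ge0.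
  lra.
have h1 : deg v * hitp e (s + s) v v <= D%:R * hitp e (s + s) v v.
  by rewrite ler_wpM2r ?hitp_ge0 ?degree_ub.
have h2 : deg x * hitp e (s + s) x x <= D%:R * hitp e (s + s) x x.
  by rewrite ler_wpM2r ?hitp_ge0 ?degree_ub.
move: pq pp; rewrite /q qq -/q -/p; lra.
Qed.

(** Of the three equal transition probabilities whose product is summed over the
    meeting points, one is bounded by its supremum; the sum of the product of the
    two others is a return probability. *)
Lemma coll_le (b : R) n v : (0 < degree e v)%N ->
    (forall y, y \in reach e v n.+1 -> hit2 e n./2.*2 y y <= b) ->
  coll n v v v <= D%:R ^+ 2 * b ^+ 2.
Proof.
move=> dv hb; have vn k : v \in reach e v k by apply: (reach_le (leq0n k)); rewrite /= in_fset1.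
have a_le y : y \in reach e v n.+1 -> hitp e n./2.*2 y y <= b.
  by move=> yR; apply: le_trans (hb y yR); rewrite /hit2 lerDl hitp_ge0.
have b0 : 0 <= b by apply: le_trans (a_le v (vn _)); rewrite hitp_ge0.
have even_le x y : (0 < degree e y)%N -> x \in reach e v n.+1 -> y \in reach e v n.+1 ->
    hitp e n./2.*2 x y <= D%:R * b.
  move=> dy xR yR; rewrite -addnn; apply: le_trans (hitp2_le _ _ dy) _.
  rewrite addnn -mulrA ler_wpM2l // mulrC ler_pdivrMr // (_ : b * 2 = b + b); last by ring.
  by rewrite lerD ?a_le.
have sup x : x \in reach e v n -> hitp e n x v <= D%:R * b.
  move=> /reach_sub xR; rewrite -(odd_double_half n); case: (odd n) => /=; last first.
    by rewrite add0n even_le.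
  rewrite add1n /hitp iter_avgS -[leRHS](avg_cst (e := e) _ dv).
  apply: avg_le => // y vy; apply: even_le => //; first exact: degree_nb vy.
  by apply: (@reach_le _ e v 1) => //; apply: reach_nb vy => //; exact: vn.
apply: (@le_trans _ _ (D%:R * b * D%:R * hitp e (n + n) v v)); last first.
  rewrite (_ : _ ^+ 2 * _ = D%:R * b * D%:R * b); last by ring.
  rewrite ler_wpM2l ?mulr_ge0 //; apply: le_trans (hb v (vn _)).
  apply: (@le_trans _ _ (hit2 e n.*2 v v)); first by rewrite addnn /hit2 lerDl hitp_ge0.
  by apply: hit2_mono => //; rewrite leq_half_double; lia.
have dv0 : 0 < deg v by rewrite ltr0n.
rewrite -(ler_pM2l dv0) /coll -(hitp_law e_sym e_fin _ _ (leqnn n)).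
rewrite [leRHS]mulrCA -(hitp_dot e_sym e_fin _ _ (leqnn n)) /dot big_distrr /=.
rewrite big_seq [leRHS]big_seq; apply: ler_sum => x xR.
have w : hitp e n x v <= D%:R * hitp e n v x :> R.
  apply: (@le_trans _ _ (deg v * hitp e n x v)).
    by rewrite ler_peMl ?hitp_ge0 // ler1n.
  by rewrite hitp_sym // ler_wpM2r ?hitp_ge0 // degree_ub.
rewrite (_ : D%:R * b * D%:R * _ =
  deg x * hitp e n v x * (D%:R * b * (D%:R * hitp e n v x))); last by ring.
by rewrite ler_wpM2l ?mulr_ge0 ?hitp_ge0 // ler_pM ?hitp_ge0 // sup.
Qed.

End Collisions.

(** * Functionals of the path *)

Section PathMean.
Context {R : realType} {V : choiceType} (e : rel V).
Hypothesis e_sym : symmetric e.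
Hypothesis e_fin : forall v, finite_set (nbhd e v).

(** The mean of a functional of the first [n] positions, the starting point
    excluded, of the walk from [x]. *)
Fixpoint path_mean (n : nat) (F : seq V -> R) (x : V) : R :=
  if n is n'.+1 then avg e (fun y => path_mean n' (fun s => F (y :: s)) y) x
  else F [::].

Lemma path_mean_le n F G x :
    (forall s, size s = n -> path e x s -> F s <= G s) ->
  path_mean n F x <= path_mean n G x.
Proof.
elim: n F G x => [|n IHn] F G x FG /=; first exact: FG.
apply: avg_le => // y xy; apply: IHn => s sn ys; apply: FG; rewrite /= ?sn //.
by rewrite xy.
Qed.

Lemma path_meanD n F G x :
  path_mean n (fun s => F s + G s) x = path_mean n F x + path_mean n G x.
Proof.
elim: n F G x => [//|n IHn] F G x /=; rewrite -avgD.
by apply: eq_avg => // y _; apply: IHn.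
Qed.

Lemma path_meanZ n c F x :
  path_mean n (fun s => c * F s) x = c * path_mean n F x.
Proof.
elim: n F x => [//|n IHn] F x /=; rewrite -avgZ.
by apply: eq_avg => // y _; apply: IHn.
Qed.

Lemma path_mean_cst n c x : (0 < degree e x)%N -> path_mean n (fun=> c) x = c.
Proof.
elim: n x => [//|n IHn] x dx /=; rewrite -[RHS](avg_cst (e := e) _ dx).
by apply: eq_avg => // y /(degree_nb e_sym e_fin); apply: IHn.
Qed.

(** The Markov property. *)
Lemma path_mean_cat m n F x :
  path_mean (m + n) F x =
  path_mean m (fun s => path_mean n (fun s' => F (s ++ s')) (last x s)) x.
Proof.
elim: m F x => [//|m IHm] F x /=.
by apply: eq_avg => // y _; rewrite IHm.
Qed.

Variable c : pred V.

Definition hits (n : nat) (x : V) : R := path_mean n (fun s => (count c s)%:R) x.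

Lemma hitsS n x : hits n.+1 x = avg e (fun y => (c y)%:R + hits n y) x.
Proof.
apply: eq_avg => // y xy.
rewrite -[X in X + _](path_mean_cst n _ (degree_nb e_sym e_fin xy)) -path_meanD.
by congr path_mean; apply/funext => s /=; rewrite natrD.
Qed.

Lemma hitsE n x :
  hits n x = \sum_(k < n) iter k.+1 (avg e) (fun y => (c y)%:R) x.
Proof.
elim: n x => [|n IHn] x; first by rewrite big_ord0.
rewrite hitsS avgD big_ord_recl; congr (_ + _).
rewrite -[RHS](iter_avg_sum e_fin _ 1) /=; apply: eq_avg => // y _; exact: IHn.
Qed.

(** After a hit at [y], the expected number of further hits is at most [G]; this
    makes the second moment of the number of hits at most [2 G + 1] times its
    mean.  The relation [I] confines the positions where the bound is needed. *)
Lemma hits_second_moment (I : nat -> V -> Prop) (G : R) n x :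
    (forall k y z, I k.+1 y -> e y z -> I k z) ->
    (forall k y, I k y -> c y -> hits k y <= G) -> I n x ->
  path_mean n (fun s => (count c s)%:R ^+ 2) x <= (2 * G + 1) * hits n x.
Proof.
move=> I_e hG; elim: n x => [|n IHn] x Ix.
  by rewrite /hits /= expr2 !mulr0.
rewrite hitsS -avgZ /=; apply: avg_le => // y xy.
have Iy := I_e _ _ _ Ix xy.
rewrite (_ : (fun s => _) = fun s =>
    ((c y)%:R + (2 * (c y)%:R) * (count c s)%:R) + (count c s)%:R ^+ 2 : R); last first.
  by apply/funext => s; rewrite natrD sqrrD; case: (c y) => /=; ring.
rewrite 2!path_meanD path_meanZ path_mean_cst ?(degree_nb e_sym e_fin xy) //.
rewrite -/(hits n y); have := IHn y Iy; have := hG n y Iy.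
case: (c y) => /= [/(_ isT)|_]; lra.
Qed.

(** Paley-Zygmund, from the inequality [2 t - t ^ 2 <= 1] at a multiple [t] of
    [count c s - a / 2]; the left-hand side is negative when [t] is. *)
Lemma paley_zygmund (b : R) n x : (0 < degree e x)%N -> 0 < b ->
    path_mean n (fun s => (count c s)%:R ^+ 2) x <= b * hits n x ->
  hits n x / (4 * b) <=
  path_mean n (fun s => (hits n x / 2 <= (count c s)%:R)%R%:R) x.
Proof.
move=> dx b0; set a := hits n x => sq.
have [l lE] : exists l, l = (2 * b)^-1 by eexists.
have l0 : 0 < l by rewrite lE invr_gt0 mulr_gt0.
have lb : l * (2 * b) = 1 by rewrite lE mulVf // gt_eqF // mulr_gt0.
have [z0 z0E] : exists z, z = - (l * a) - l ^+ 2 * a ^+ 2 / 4 by eexists.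
apply: (@le_trans _ _ (path_mean n (fun s => z0 +
    ((2 * l + l ^+ 2 * a) * (count c s)%:R + (- l ^+ 2) * (count c s)%:R ^+ 2)) x)).
  rewrite 2!path_meanD path_mean_cst // !path_meanZ -/(hits n x) -/a z0E.
  have : l ^+ 2 * path_mean n (fun s => (count c s)%:R ^+ 2) x <= l ^+ 2 * (b * a).
    by rewrite ler_wpM2l // sqr_ge0.
  have -> : l ^+ 2 * (b * a) = l * a / 2.
    have -> : l ^+ 2 * (b * a) = l * (2 * b) * (l * a / 2) by field.
    by rewrite lb mul1r.
  have -> : a / (4 * b) = l * a / 2 by rewrite lE; field; rewrite gt_eqF.
  have : 0 <= l ^+ 2 * a ^+ 2 by rewrite mulr_ge0 ?sqr_ge0.
  set z := path_mean _ _ _; lra.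
apply: path_mean_le => s _ _; set k := (count c s)%:R; rewrite z0E.
have -> : - (l * a) - l ^+ 2 * a ^+ 2 / 4 + ((2 * l + l ^+ 2 * a) * k + - l ^+ 2 * k ^+ 2) =
  2 * (l * (k - a / 2)) - (l * (k - a / 2)) ^+ 2 by field.
set t := l * _; have t1 := sqr_ge0 (t - 1); case: (leP (a / 2) k) => ka /=; first by move: t1; lra.
have : t < 0 by rewrite /t pmulr_rlt0 // subr_lt0.
by have := sqr_ge0 t; lra.
Qed.

(** Blocks: if at every time, from every possible position, the target is reached
    within some later time with probability at least [d], then it is missed during
    [J] successive blocks with probability at most [(1 - d) ^ J]. *)
Lemma missed_targets (o : V) (g : nat -> R) (d : R) :
    (0 < degree e o)%N -> d <= 1 ->
    (forall m, exists n, forall s, size s = m -> path e o s ->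
      d <= path_mean n (fun s' => (g (m + n)%N <= (count c s')%:R)%R%:R) (last o s)) ->
  forall J m, exists2 N, (m <= N)%N &
    path_mean N (fun s => (all (fun k => (count c (take k s))%:R < g k)
      (iota m (N.+1 - m)))%:R) o <= (1 - d) ^+ J.
Proof.
move=> d_o d1 target J m; elim: J => [|J [N mN IHJ]].
  exists m => //; rewrite expr0 -[leRHS](path_mean_cst m 1 d_o).
  by apply: path_mean_le => s _ _; case: (all _ _).
have [n Hn] := target N; exists (N + n)%N; first by rewrite (leq_trans mN) ?leq_addr.
rewrite path_mean_cat exprS; apply: le_trans (ler_wpM2l _ IHJ); last by rewrite subr_ge0.
rewrite -path_meanZ; apply: path_mean_le => s sN os.
set b := all (fun k => (count c (take k s))%:R < g k) (iota m (N.+1 - m)).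
have ds : (0 < degree e (last o s))%N.
  by case/lastP: s os {sN b} => // s z; rewrite rcons_path last_rcons => /andP[_ /degree_nb]; apply.
apply: (@le_trans _ _ (path_mean n (fun s' => b%:R + (- b%:R) *
    (g (N + n)%N <= (count c s')%:R)%R%:R) (last o s))); last first.
  rewrite path_meanD path_mean_cst // path_meanZ.
  have : b%:R * d <= b%:R * path_mean n (fun s' =>
      (g (N + n)%N <= (count c s')%:R)%R%:R) (last o s) by rewrite ler_wpM2l // Hn.
  by rewrite -/b; lra.
apply: path_mean_le => s' s'n _.
case: (boolP (all _ _)) => [/allP miss|_]; last first.
  by case: b; case: (g _ <= _) => /=; lra.
have -> : b = true.
  apply/allP => k; rewrite mem_iota => /andP[mk kN].
  have := miss k; rewrite mem_iota takel_cat ?sN; last by lia.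
  by apply; lia.
have : (count c (take (N + n) (s ++ s')))%:R < g (N + n)%N.
  by apply: miss; rewrite mem_iota; lia.
rewrite take_oversize ?size_cat ?sN ?s'n // count_cat natrD => lt.
have -> : (g (N + n)%N <= (count c s')%:R) = false.
  by apply/negbTE; rewrite -ltNge (le_lt_trans _ lt) ?lerDr.
by rewrite mulr0 addr0.
Qed.
End PathMean.

(** * The law of the path of a simple random walk *)

Section PathLaw.
Context {R : realType} {V : countType} (e : rel V).
Hypothesis e_fin : forall v, finite_set (nbhd e v).
Context {d : measure_display} {T : measurableType d}.
Variables (P : probability T R) (X : nat -> T -> V) (o : V).
Hypothesis X_meas : forall n (A : set V), measurable (X n @^-1` A).

Lemma measurable_cylinder v n : measurable (cylinder X v n).
Proof.
rewrite (_ : cylinder X v n = \bigcap_(i in [set i | (i <= n)%N]) X i @^-1` [set v i]).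
  by apply: bigcap_measurable => [|i _]; [exists 0%N | apply: X_meas].
by apply/seteqP; split => t Ht i; apply: Ht.
Qed.

Lemma measurable_path m n (D : pred (seq V)) :
  measurable [set t | D [seq X i t | i <- iota m n]].
Proof.
elim: n m D => [|n IHn] m D.
  by case DE : (D [::]); [rewrite (_ : mkset _ = setT) | rewrite (_ : mkset _ = set0)];
    rewrite //; apply/seteqP; split=> t //=; rewrite DE.
rewrite (_ : mkset _ = \bigcup_y (X m @^-1` [set y] `&`
    [set t | D (y :: [seq X i t | i <- iota m.+1 n])])).
  apply: countable_bigcupT_measurable => [|y]; first exact: countableP.
  by apply: measurableI; [apply: X_meas | apply: IHn m.+1 (fun s => D (y :: s))].
by apply/seteqP; split => t /=; [exists (X m t) | case=> y _ [/= <-]].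
Qed.

Lemma cylinderS v m y :
  cylinder X (fun i => if i == m.+1 then y else v i) m.+1 =
  cylinder X v m `&` X m.+1 @^-1` [set y].
Proof.
apply/seteqP; split => [t /= Ht|t /= [Ht Xy] i].
  split=> [i im|]; last by rewrite /= (Ht m.+1) // eqxx.
  by rewrite (Ht i (leqW im)) ltn_eqF.
by rewrite leq_eqVlt; case: eqP => [->//|_ /= im]; apply: Ht.
Qed.

Hypothesis X_step : forall n v,
  P (cylinder X v n.+1) = (P (cylinder X v n) * (srw_kernel e (v n) (v n.+1))%:E)%E.

(** The defining one-step relation determines the law of the path: conditioning
    on the next position is a finite sum, since the other positions have
    probability zero. *)
Lemma srw_path_cylinder m n v (D : pred (seq V)) :
  P (cylinder X v m `&` [set t | D [seq X i t | i <- iota m.+1 n]]) =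
  (P (cylinder X v m) * (path_mean e n (fun s => (D s)%:R) (v m))%:E)%E.
Proof.
elim: n m v D => [|n IHn] m v D.
  rewrite /=; case DE : (D [::]).
    by rewrite (_ : mkset _ = setT) ?setIT ?mule1 //; apply/seteqP; split => t //=.
  by rewrite (_ : mkset _ = set0) ?setI0 ?measure0 ?mule0 //; apply/seteqP; split => t //=.
pose A y := cylinder X v m `&` X m.+1 @^-1` [set y] `&`
  [set t | D (y :: [seq X i t | i <- iota m.+2 n])].
have mA y : measurable (A y).
  apply: measurableI; first by apply: measurableI; [apply: measurable_cylinder|].
  exact: (measurable_path m.+2 n (fun s => D (y :: s))).
have PA y : P (A y) = (P (cylinder X v m) * (srw_kernel e (v m) y)%:E *
    (path_mean e n (fun s => (D (y :: s))%:R) y)%:E)%E.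
  rewrite /A -cylinderS (IHn m.+1 _ (fun s => D (y :: s))) X_step eqxx.
  rewrite (_ : cylinder X _ m = cylinder X v m); last first.
    by apply/seteqP; split => t H i im; rewrite (H i im) ltn_eqF.
  by case: eqP => // /n_Sn.
set B := _ `&` _; have mB : measurable B.
  by apply: measurableI; [apply: measurable_cylinder | apply: measurable_path].
pose U := \big[setU/set0]_(y <- nb e (v m)) A y.
have mU : measurable U by apply: bigsetU_measurable => y _; apply: mA.
have UB : U `<=` B.
  rewrite /U -bigcup_fset => t [y _ [[cy /= <-] Dy]]; split => //.
have null : P.-negligible (B `\` U).
  pose F k : set T := if (choice.unpickle k : option V) is Some y then
    if e (v m) y then set0 else A y else set0.
  apply: (@negligibleS _ _ _ _ (\bigcup_k F k)).
    move=> t [[ct Dt] Ut]; exists (choice.pickle (X m.+1 t)) => //.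
    rewrite /F choice.pickleK; case: ifP => [vX|_]; last by split; first by split.
    apply: Ut; rewrite /U -bigcup_fset; exists (X m.+1 t) => //=.
    by rewrite in_nb.
  apply: negligible_bigcup => k; rewrite /F.
  case: (choice.unpickle k) => [y|]; last exact: negligible_set0.
  case: ifP => [_|vy]; first exact: negligible_set0.
  apply/(negligibleP _ (mA y)); rewrite [LHS](_ : _ = P (A y)) // PA.
  by rewrite /srw_kernel vy mule0 mul0e.
have -> : P B = P U.
  rewrite -(setDUK UB) measureU //; last 2 first.
  - exact: measurableD.
  - by apply/seteqP; split => t // -[Ut [_ /(_ Ut)]].
  by rewrite (measure_negligible _ null) ?adde0 //; apply: measurableD.
rewrite /U measure_fbigsetU //; last first.
  by move=> y z _ _ [t [[[_ /= <-] _] [[_ /= ->]]]].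
rewrite /= /avg big_distrr /= -sumEFin ge0_sume_distrr => [|y _]; last first.
  rewrite lee_fin mulr_ge0 ?invr_ge0 //.
  rewrite -[X in X <= _](mul0r (path_mean e n (fun=> 1) y)) -path_meanZ //.
  by apply: path_mean_le => // s _ _; case: (D _); rewrite mul0r.
rewrite big_seq [RHS]big_seq; apply: eq_bigr => y; rewrite in_nb // => vy.
by rewrite PA /srw_kernel vy EFinM muleA.
Qed.

Hypothesis X_start : P (X 0%N @^-1` [set o]) = 1%E.

Lemma srw_path n (D : pred (seq V)) :
  P [set t | D [seq X i t | i <- iota 1 n]] =
  (path_mean e n (fun s => (D s)%:R) o)%:E.
Proof.
have cyl0 : cylinder X (fun=> o) 0 = X 0%N @^-1` [set o].
  by apply/seteqP; split => t /= => [/(_ 0%N)->//|Xo i]; rewrite leqn0 => /eqP->.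
have := srw_path_cylinder 0 n (fun=> o) D.
rewrite cyl0 X_start mul1e => <-; rewrite setIC.
set B := mkset _; set A := _ @^-1` _.
have mB : measurable B by exact: measurable_path.
have mA : measurable A by exact: X_meas.
have null : P.-negligible (~` A).
  apply/(negligibleP _ (measurableC mA)).
  by rewrite [LHS](_ : _ = P (~` A)) // probability_setC // X_start subee.
have mBA : measurable (B `&` A) by exact: measurableI.
have mD : measurable (B `\` B `&` A) by exact: measurableD.
have z : P (B `\` B `&` A) = 0%E.
  apply: (measure_negligible mD); apply: negligibleS null => t [Bt BAt] At.
  by apply: BAt.
rewrite -[in LHS](setDUK (@subIsetl _ B A)) measureU //; last first.
  by apply/seteqP; split => t // -[BA [_ /(_ BA)]].
by rewrite [X in (_ + X)%E](_ : _ = 0%E) ?adde0.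
Qed.

End PathLaw.

(** * Product graphs and triples of independent walks *)

(** Both coordinates move at every step, unlike in the cartesian product of
    graphs: this is the graph on which two independent walks form one walk. *)
Definition tensor {V1 V2 : choiceType} (e1 : rel V1) (e2 : rel V2) : rel (V1 * V2) :=
  fun x y => e1 x.1 y.1 && e2 x.2 y.2.

Section Tensor.
Context {R : realType} {V1 V2 : choiceType} (e1 : rel V1) (e2 : rel V2).
Hypothesis e1_fin : forall v, finite_set (nbhd e1 v).
Hypothesis e2_fin : forall v, finite_set (nbhd e2 v).

Lemma tensor_sym : symmetric e1 -> symmetric e2 -> symmetric (tensor e1 e2).
Proof. by move=> s1 s2 x y; rewrite /tensor s1 s2. Qed.

Lemma nbhd_tensor x : nbhd (tensor e1 e2) x = nbhd e1 x.1 `*` nbhd e2 x.2.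
Proof. by apply/seteqP; split => -[a b] /= => [/andP|[xa xb]]; last apply/andP. Qed.

Lemma tensor_fin x : finite_set (nbhd (tensor e1 e2) x).
Proof. by rewrite nbhd_tensor; apply: finite_setX. Qed.

Lemma perm_nb_tensor x :
  perm_eq (nb (tensor e1 e2) x) [seq (a, b) | a <- nb e1 x.1, b <- nb e2 x.2].
Proof.
apply: uniq_perm; rewrite ?fset_uniq ?allpairs_uniq ?fset_uniq //.
  by move=> [a b] [a' b'] _ _ /= [-> ->].
move=> [a b]; rewrite in_nb; last exact: tensor_fin.
apply/idP/allpairsP => [/andP[xa xb]|[[a' b'] /= [xa xb [-> ->]]]].
  by exists (a, b); rewrite /= !in_nb.
by rewrite /tensor /=; apply/andP; rewrite -!in_nb.
Qed.

Lemma degree_tensor x :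
  degree (tensor e1 e2) x = (degree e1 x.1 * degree e2 x.2)%N.
Proof. by rewrite /degree -!/(nb _ _) (perm_size (perm_nb_tensor x)) size_allpairs. Qed.

Lemma srw_kernel_tensor x y : srw_kernel (tensor e1 e2) x y =
  srw_kernel e1 x.1 y.1 * srw_kernel e2 x.2 y.2 :> R.
Proof.
rewrite /srw_kernel degree_tensor /tensor natrM invfM.
by case: (e1 _ _); case: (e2 _ _); rewrite /= ?mulr0 ?mul0r.
Qed.

Lemma avg_tensor (F : V1 * V2 -> R) x :
  avg (tensor e1 e2) F x = avg e1 (fun a => avg e2 (fun b => F (a, b)) x.2) x.1.
Proof.
rewrite /avg degree_tensor natrM invfM (perm_big _ (perm_nb_tensor x)) big_allpairs.
by rewrite -mulrA; congr (_ * _); rewrite big_distrr.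
Qed.

(** The averages over the two coordinates commute, so that the steps of one can
    all be taken before those of the other. *)
Lemma iter_avg_tensor n (F : V1 * V2 -> R) x :
  iter n (avg (tensor e1 e2)) F x =
  iter n (avg e1) (fun a => iter n (avg e2) (fun b => F (a, b)) x.2) x.1.
Proof.
elim: n x => [|n IHn] [x y] //=; rewrite avg_tensor /=.
apply: eq_avg => // a _.
transitivity (avg e2 (fun b => iter n (avg e1)
    (fun a => iter n (avg e2) (fun b => F (a, b)) b) a) y).
  by apply: eq_avg => // b _; rewrite IHn.
rewrite {1}/avg -(iter_avg_sum e1_fin) -iter_avgZ //.
Qed.

End Tensor.

Definition triple {V : choiceType} (e : rel V) : rel (V * V * V) :=
  tensor (tensor e e) e.

Definition meet {V : eqType} (z : V * V * V) : bool :=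
  (z.1.1 == z.1.2) && (z.1.2 == z.2).

Section Triple.
Context {R : realType} {V : choiceType} (e : rel V).
Hypothesis e_sym : symmetric e.
Hypothesis e_fin : forall v, finite_set (nbhd e v).

Lemma triple_sym : symmetric (triple e).
Proof. by do !apply: tensor_sym. Qed.

Lemma triple_fin x : finite_set (nbhd (triple e) x).
Proof. by do !apply: tensor_fin => // ?. Qed.

Lemma degree_triple z :
  degree (triple e) z = (degree e z.1.1 * degree e z.1.2 * degree e z.2)%N.
Proof. by rewrite !degree_tensor //; apply: tensor_fin. Qed.

(** The three coordinates are averaged one after the other. *)
Lemma iter_meet n u v w :
  iter n (avg (triple e)) (fun z => (meet z)%:R) (u, v, w) = coll e n u v w :> R.
Proof.
rewrite iter_avg_tensor //=; last by apply: tensor_fin.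
rewrite iter_avg_tensor //=; apply: eq_iter_avg => x.
transitivity (iter n (avg e) (fun b => hitp e n x w * (b == x)%:R) v : R).
  apply: eq_iter_avg => y; rewrite mulrC eq_sym.
  have [<-|xy] := eqVneq x y.
    rewrite mul1r; apply: eq_iter_avg => z.
    by rewrite /meet /= eqxx /= eq_sym.
  rewrite mul0r -[RHS](mul0r (iter n (avg e) (fun=> 0 : R) w)) -iter_avgZ //.
  by apply: eq_iter_avg => z; rewrite /meet /= (negPf xy) mul0r.
by rewrite iter_avgZ // mulrC.
Qed.

Lemma hits_meet n u v w :
  hits (triple e) meet n (u, v, w) = \sum_(k < n) coll e k.+1 u v w :> R.
Proof.
rewrite hitsE; [|exact: triple_sym|exact: triple_fin].
by apply: eq_bigr => k _; apply: iter_meet.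
Qed.

End Triple.

Section TripleProcess.
Context {R : realType} {V : countType} (e : rel V).
Hypothesis e_fin : forall v, finite_set (nbhd e v).
Context {d : measure_display} {T : measurableType d}.
Variables (P : probability T R) (X Y Z : nat -> T -> V) (o : V).
Hypothesis hX : simple_random_walk e P X o.
Hypothesis hY : simple_random_walk e P Y o.
Hypothesis hZ : simple_random_walk e P Z o.
Hypothesis XYZ_indep : independent3 P X Y Z.

Lemma process_sigmaI (X' : nat -> T -> V) A B :
  process_sigma X' A -> process_sigma X' B -> process_sigma X' (A `&` B).
Proof.
pose G : set (set T) := [set E | exists n (A : set V), E = X' n @^-1` A].
exact: (@measurableI _ (g_sigma_algebraType G) A B).
Qed.

Lemma process_sigma_preimage (X' : nat -> T -> V) n A :
  process_sigma X' (X' n @^-1` A).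
Proof. by apply: sub_sigma_algebra; exists n, A. Qed.

Lemma process_sigma_cylinder (X' : nat -> T -> V) v n :
  process_sigma X' (cylinder X' v n).
Proof.
elim: n => [|n IHn].
  rewrite (_ : cylinder _ _ _ = X' 0%N @^-1` [set v 0%N]).
    exact: process_sigma_preimage.
  by apply/seteqP; split => t /= => [/(_ 0%N)->//|Xo i]; rewrite leqn0 => /eqP->.
rewrite (_ : cylinder _ _ _ = cylinder X' v n `&` X' n.+1 @^-1` [set v n.+1]).
  by apply: process_sigmaI => //; apply: process_sigma_preimage.
apply/seteqP; split => [t /= Ht|t /= [Ht Xv] i].
  by split=> [i im|]; apply: Ht; rewrite // leqW.
by rewrite leq_eqVlt ltnS => /orP[/eqP->//|]; apply: Ht.
Qed.

Definition joint (n : nat) (t : T) : V * V * V := (X n t, Y n t, Z n t).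

Lemma joint_meas n (A : set (V * V * V)) : measurable (joint n @^-1` A).
Proof.
have [mX _ _] := hX; have [mY _ _] := hY; have [mZ _ _] := hZ.
rewrite (_ : _ @^-1` A = \bigcup_z (if z \in A then X n @^-1` [set z.1.1] `&`
   Y n @^-1` [set z.1.2] `&` Z n @^-1` [set z.2] else set0)).
  apply: countable_bigcupT_measurable => [|z]; first exact: countableP.
  by case: ifP => // _; apply: measurableI => //; apply: measurableI.
apply/seteqP; split => t /= => [At|[[[x y] z] _]].
  by exists (joint n t) => //; rewrite mem_set.
by case: ifPn => // /set_mem Az [[/= Xx Yy] Zz]; rewrite /joint Xx Yy Zz.
Qed.

Lemma cylinder_joint v n : cylinder joint v n =
  cylinder X (fun i => (v i).1.1) n `&` cylinder Y (fun i => (v i).1.2) n `&`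
  cylinder Z (fun i => (v i).2) n.
Proof.
apply/seteqP; split => t /=.
  by move=> H; split; [split|] => i /H <-.
move=> [[HX HY] HZ] i im; rewrite /joint HX // HY // HZ //.
by case: (v i) => [[]].
Qed.

(** By independence the probabilities of the cylinders of the joint process are
    products, and so are the transition probabilities on the product graph. *)
Lemma joint_srw : simple_random_walk (triple e) P joint (o, o, o).
Proof.
have [_ X0 XS] := hX; have [_ Y0 YS] := hY; have [_ Z0 ZS] := hZ.
split; first exact: joint_meas.
  rewrite (_ : _ @^-1` _ = X 0%N @^-1` [set o] `&` Y 0%N @^-1` [set o] `&`
      Z 0%N @^-1` [set o]); last first.
    by rewrite /joint; apply/seteqP; split => t /= => [[-> -> ->]|[[-> ->] ->]].
  rewrite XYZ_indep; try exact: process_sigma_preimage.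
  by rewrite X0 Y0 Z0 !mule1.
move=> n v; rewrite !cylinder_joint.
rewrite !XYZ_indep; try exact: process_sigma_cylinder.
rewrite XS YS ZS !srw_kernel_tensor ?EFinM //; last exact: tensor_fin.
set a := P _; set b := P _; set c := P _.
by rewrite [X in (X * _)%E = _]muleACA [LHS]muleACA.
Qed.

End TripleProcess.

(** * Combs *)

Section Comb.
Context {R : realType}.
Variable H : nat -> nat.

Definition vertex (v : int * int) : bool :=
  (0 <= v.2) && (`|v.2| <= H `|v.1|)%N.

(** Natural heights suffice: only the integer part of the bound on the second
    coordinate matters. *)
Definition comb : rel (int * int) := fun u v =>
  [&& vertex u, vertex v & comb_step u v || comb_step v u].

Lemma comb_sym : symmetric comb.
Proof. by move=> u v; rewrite /comb andbCA orbC. Qed.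

Definition candidates (v : int * int) : seq (int * int) :=
  [:: (v.1 + 1, v.2); (v.1 - 1, v.2); (v.1, v.2 + 1); (v.1, v.2 - 1)].

Lemma comb_candidates u v : comb u v -> v \in candidates u.
Proof.
case: u v => [a b] [c d] /and3P[_ _]; rewrite /comb_step /= !inE /=.
by case/orP => /orP[/andP[/eqP-> /eqP[-> ->]]|/eqP[-> ->]];
  rewrite ?addrK ?eqxx ?orbT.
Qed.

Lemma comb_fin v : finite_set (nbhd comb v).
Proof.
apply: (@sub_finite_set _ _ [set` candidates v]); last exact: finite_seq.
by move=> w /comb_candidates.
Qed.
Hint Resolve comb_fin : core.

Lemma uniq_candidates v : uniq (candidates v).
Proof.
by case: v => a b; rewrite /candidates /= !inE /= !xpair_eqE /=; lia.
Qed.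

Lemma comb_sum (f : int * int -> R) v :
  \sum_(y <- nb comb v) f y = \sum_(y <- candidates v | comb v y) f y.
Proof.
rewrite -[RHS]big_filter; apply/perm_big/uniq_perm.
- exact: fset_uniq.
- exact/filter_uniq/uniq_candidates.
move=> y; rewrite mem_filter in_nb //.
by have [/comb_candidates->|//] := boolP (comb v y).
Qed.

Lemma comb_horizontal m n : comb (m, 0) (n, 0) = (n == m + 1) || (m == n + 1).
Proof. by rewrite /comb /vertex /comb_step /= !xpair_eqE !eqxx /= !andbT !andbF !orbF. Qed.

Lemma comb_vertical m (j : nat) : comb (m, j%:Z) (m, j.+1%:Z) = (j < H `|m|)%N.
Proof.
rewrite /comb /vertex /comb_step /= !xpair_eqE !eqxx /=.
by rewrite (_ : (j.+1%:Z == j%:Z + 1) = true) ?orbT ?andbT; [apply/andP/idP; lia|apply/eqP; lia].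
Qed.

Lemma comb_tooth m n (j : nat) : m != n -> comb (m, j.+1%:Z) (n, j.+1%:Z) = false.
Proof.
move=> mn; rewrite /comb /comb_step /= !xpair_eqE (negPf mn) (eq_sym n) (negPf mn) /=.
by rewrite !andbF.
Qed.

Lemma base_sum (f : int * int -> R) m :
  \sum_(y <- nb comb (m, 0)) f y =
  f (m + 1, 0) + f (m - 1, 0) + (0 < H `|m|)%:R * f (m, 1).
Proof.
rewrite comb_sum big_mkcond /candidates !big_cons big_nil /=.
rewrite !addr0 (_ : 0 + 1 = 1 :> int) // !comb_horizontal subrK !eqxx orbT /=.
by rewrite (comb_vertical m 0); case: (0 < _)%N; rewrite ?mul1r ?mul0r ?addrA.
Qed.

Lemma tooth_sum (f : int * int -> R) m (j : nat) : (j < H `|m|)%N ->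
  \sum_(y <- nb comb (m, j.+1%:Z)) f y =
  (j.+1 < H `|m|)%:R * f (m, j.+2%:Z) + f (m, j%:Z).
Proof.
move=> jH; rewrite comb_sum big_mkcond /candidates !big_cons big_nil /=.
rewrite !comb_tooth ?add0r; [|lia|lia].
rewrite (_ : j.+1%:Z + 1 = j.+2%:Z); last by lia.
rewrite (_ : j.+1%:Z - 1 = j%:Z); last by lia.
rewrite comb_vertical comb_sym comb_vertical jH addr0.
by case: (j.+1 < _)%N; rewrite ?mul1r ?mul0r.
Qed.

Lemma degree_sum v : (degree comb v)%:R = \sum_(y <- nb comb v) 1 :> R.
Proof. by rewrite big_const_seq count_predT iter_addr_0. Qed.

Lemma degree_base m : (degree comb (m, 0%N%:Z))%:R = 2 + (0 < H `|m|)%:R :> R.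
Proof. by rewrite degree_sum base_sum mulr1. Qed.

Lemma degree_tooth m (j : nat) : (j < H `|m|)%N ->
  (degree comb (m, j.+1%:Z))%:R = (j.+1 < H `|m|)%:R + 1 :> R.
Proof. by move=> jH; rewrite degree_sum tooth_sum // mulr1. Qed.

Lemma degree_nonvertex v : ~~ vertex v -> degree comb v = 0%N.
Proof.
move=> nv; rewrite /degree (_ : nbhd comb v = set0) ?fset_set0 ?cardfs0 //.
by apply/seteqP; split => // w; rewrite /nbhd /= /comb (negPf nv).
Qed.

Lemma vertexP v : reflect (exists m (j : nat), v = (m, j%:Z) /\ (j <= H `|m|)%N) (vertex v).
Proof.
apply: (iffP andP); case: v => m b /=.
  by case: b => j [] // _ jH; exists m, j.
by move=> [m' [j [[-> ->] jH]]]; split.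
Qed.

Lemma degree_vertex v : vertex v -> (0 < degree comb v)%N.
Proof.
case/vertexP => m [[|j] [-> jH]]; rewrite -(ltr0n R).
  by rewrite degree_base; case: (0 < _)%N => /=; lra.
by rewrite degree_tooth //; case: (_ < _)%N => /=; lra.
Qed.

Lemma degree_le3 v : (degree comb v <= 3)%N.
Proof.
have [/vertexP[m [[|j] [-> jH]]]|/degree_nonvertex->//] := boolP (vertex v);
  rewrite -(ler_nat R).
  by rewrite degree_base; case: (0 < _)%N => /=; lra.
by rewrite degree_tooth //; case: (_ < _)%N => /=; lra.
Qed.

Lemma vertex_comb u v : comb u v -> vertex v.
Proof. by case/and3P. Qed.

Definition colour (v : int * int) : bool := odd (`|v.1| + `|v.2|)%N.

Lemma comb_colour x y : comb x y -> colour y = ~~ colour x.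
Proof.
have up u v : vertex u -> comb_step u v -> colour v = ~~ colour u.
  have oddS (a : int) : odd `|a + 1| = ~~ odd `|a|.
    case: a => n; first by rewrite (_ : absz (n%:Z + 1) = n.+1) //; lia.
    by rewrite (_ : absz (Negz n + 1) = n) /= ?negbK //; lia.
  case: u v => [a b] [c d] _ /orP[/= /andP[/eqP-> /eqP[-> ->]]|/eqP[-> ->]];
  by rewrite /colour /= !oddD oddS; case: (odd _); case: (odd _).
by case/and3P => vx vy /orP[/(up _ _ vx)|/(up _ _ vy) ->]; rewrite ?negbK.
Qed.

Lemma comb_fst x y : comb x y -> (`|y.1| <= `|x.1| + 1)%N.
Proof. by case: x y => [a b] [c d] /comb_candidates; rewrite !inE => /or4P[]/eqP[-> _] /=; lia. Qed.

Lemma reach_comb v n x : vertex v -> x \in reach comb v n ->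
  vertex x /\ (`|x.1| <= `|v.1| + n)%N.
Proof.
move=> vv; elim: n x => [|n IHn] x /=.
  by rewrite in_fset1 => /eqP->; rewrite addn0.
rewrite in_fsetU => /orP[/IHn[vx xn]|]; first by split => //; apply: leq_trans xn _; rewrite leq_add2l.
case/bigfcupP => y; rewrite andbT => /IHn[vy yn]; rewrite in_nb // => yx.
split; first exact: vertex_comb yx.
  by apply: leq_trans (comb_fst yx) _; rewrite addn1 addnS ltnS.
Qed.

(** ** Distances *)

Lemma dist_le_trans (V : choiceType) (e : rel V) r s x y z :
  dist_le e r x y -> dist_le e s y z -> dist_le e (r + s) x z.
Proof.
move=> [p [xp <- pr]] [q [yq <- qs]]; exists (p ++ q).
by rewrite cat_path xp yq last_cat size_cat leq_add.
Qed.

Lemma dist_le_sym r x y : dist_le comb r x y -> dist_le comb r y x.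
Proof.
move=> [p [xp yE pr]]; exists (rev (belast x p)); split.
- have := rev_path comb x p; rewrite yE => ->.
  by rewrite (eq_path (e' := comb)) // => a b; apply: comb_sym.
- by case: p yE {xp pr} => [<-|a p _] //=; rewrite rev_cons last_rcons.
- by rewrite size_rev size_belast.
Qed.

Lemma dist_le_weak (V : choiceType) (e : rel V) r s x y :
  (r <= s)%N -> dist_le e r x y -> dist_le e s x y.
Proof. by move=> rs [p [xp <- pr]]; exists p; split => //; apply: leq_trans rs. Qed.

Lemma dist_le_up m (i k : nat) : (i + k <= H `|m|)%N ->
  dist_le comb k (m, i%:Z) (m, (i + k)%N%:Z).
Proof.
elim: k => [|k IHk] kH; first by rewrite addn0; exists [::].
rewrite addnS in kH *; rewrite -[X in dist_le _ X]addn1.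
apply: (dist_le_trans (IHk (ltnW kH))).
by exists [:: (m, (i + k).+1%:Z)]; rewrite /= comb_vertical kH.
Qed.

Lemma dist_le_base m n : dist_le comb `|n - m| (m, 0) (n, 0).
Proof.
have right (a : int) (k : nat) : dist_le comb k (a, 0) (a + k%:Z, 0).
  elim: k => [|k IHk]; first by rewrite addr0; exists [::].
  rewrite -addn1; apply: (dist_le_trans IHk).
  by exists [:: (a + (k + 1)%N%:Z, 0)]; rewrite /= comb_horizontal PoszD addrA eqxx.
have [mn|nm] := leP m n.
  by have := right m `|n - m|%N; rewrite (_ : m + _ = n) //; lia.
apply: dist_le_sym.
have := right n `|n - m|%N; rewrite (_ : n + _ = m) //; lia.
Qed.

Lemma dist_le_comb m (i : nat) n (j : nat) r : (i <= H `|m|)%N -> (j <= H `|n|)%N ->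
  (i + `|n - m| + j <= r)%N -> dist_le comb r (m, i%:Z) (n, j%:Z).
Proof.
move=> im jn ijr; apply: (dist_le_weak ijr).
apply: dist_le_trans (dist_le_up (i := 0) jn); apply: dist_le_trans (dist_le_base m n).
exact/dist_le_sym/(dist_le_up (i := 0)).
Qed.

End Comb.

(** * Return probabilities on combs *)

Section CombReturn.
Context {R : realType}.
Variable H : nat -> nat.
Hypothesis H_mono : {homo H : m n / (m <= n)%N}.

Let e := comb H.
Let e_sym : symmetric e := comb_sym H.
Let e_fin : forall v, finite_set (nbhd e v) := @comb_fin H.
Let e_deg : forall v, (degree e v <= 3)%N := @degree_le3 R H.
Let deg_vertex : forall v, vertex H v -> (0 < degree e v)%N := @degree_vertex R H.

(** At small times a walk sees a half-line: the part of its tooth below it, or the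
    base. *)
Lemma comb_return_line v (r t : nat) : vertex H v -> (0 < r)%N ->
  (24 * r * r <= t)%N -> hit2 e t.*2 v v <= 12 / r%:R :> R.
Proof.
move=> /vertexP[m [j [-> jH]]] r0 rt.
have line (B : nat -> int * int) : injective B ->
    (forall k, (k < r)%N -> vertex H (B k) /\ dist_le e (2 * r) (m, j%:Z) (B k)) ->
    hit2 e t.*2 (m, j%:Z) (m, j%:Z) <= 12 / r%:R :> R.
  move=> B_inj HB; have sB : size [seq B k | k <- iota 0 r] = r by rewrite size_map size_iota.
  have := @return_le R _ e e_sym e_fin 3 (2 * r) t [seq B k | k <- iota 0 r] (m, j%:Z).
  rewrite sB -natrM; apply => //; last by lia.
  - by apply: deg_vertex; apply/vertexP; exists m, j.
  - by rewrite map_inj_uniq // iota_uniq.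
  - by move=> x /mapP[k]; rewrite mem_iota => kr ->; apply: (HB k _).2.
  - by move=> x /mapP[k]; rewrite mem_iota => kr ->; apply/deg_vertex/(HB k _).1.
have [rj|jr] := leqP r j.
  apply: (line (fun k => (m, j%:Z - k%:Z))) => [k l [] /=|k kr]; first by lia.
  rewrite (_ : j%:Z - k%:Z = (j - k)%N%:Z); last by lia.
  split; first by apply/vertexP; exists m, (j - k)%N; split => //; lia.
  have := @dist_le_up H m (j - k) k; rewrite subnK; last by lia.
  by move=> /(_ jH)/dist_le_sym; apply: dist_le_weak; lia.
apply: (line (fun k => (m + k%:Z, 0))) => [k l [] /=|k kr]; first by lia.
split; first by apply/vertexP; exists (m + k%:Z), 0%N.
by apply: (dist_le_comb jH) => //; lia.
Qed.

(** At larger times it sees a box of the comb, away from the origin where the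
    teeth are shorter. *)
Lemma comb_return_box m (j r h t : nat) : (j <= H `|m|)%N -> (0 < r)%N -> (0 < h)%N ->
  (h <= (H r).+1)%N -> (j + h <= 2 * r)%N -> (48 * r * r * h <= t)%N ->
  hit2 e t.*2 (m, j%:Z) (m, j%:Z) <= 12 / (r * h)%:R :> R.
Proof.
move=> jH r0 h0 hH jr tr.
pose s : int := if 0 <= m then 1 else -1.
pose pt (z : nat * nat) : int * int := (m + s * (r + z.1)%:Z, z.2%:Z).
pose B := [seq pt z | z <- [seq (k, i) | k <- iota 0 r, i <- iota 0 h]].
have sB : size B = (r * h)%N by rewrite size_map size_allpairs !size_iota.
have ptP z : z \in [seq (k, i) | k <- iota 0 r, i <- iota 0 h] ->
    vertex H (pt z) /\ dist_le e (4 * r) (m, j%:Z) (pt z).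
  case/allpairsP => -[k i] /= []; rewrite !mem_iota => kr ir ->.
  have far : (r <= absz (pt (k, i)).1)%N by rewrite /pt /s /=; case: ifP; lia.
  have iH : (i <= H (absz (pt (k, i)).1))%N by apply: leq_trans (H_mono far); lia.
  split; first by apply/vertexP; exists (m + s * (r + k)%:Z), i.
  by apply: (dist_le_comb jH iH); rewrite /pt /s /=; case: ifP; lia.
have := @return_le R _ e e_sym e_fin 3 (4 * r) t B (m, j%:Z).
rewrite sB -natrM; apply => //.
- by apply: deg_vertex; apply/vertexP; exists m, j.
- rewrite map_inj_uniq.
    apply: allpairs_uniq; rewrite ?iota_uniq //.
    by move=> [k i] [k' i'] _ _ /= [-> ->].
  move=> [k i] [k' i'] /= []; rewrite /pt /s; case: ifP => _ /=.
    by move=> h1 h2; congr pair; lia.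
  by move=> h1 h2; congr pair; lia.
- by rewrite muln_gt0 r0.
- by move=> x /mapP[z /ptP[_ ?] ->].
- by move=> x /mapP[z /ptP[/deg_vertex ? _] ->].
- by rewrite (_ : (4 * 3 * (4 * r) * (r * h) = 48 * r * r * h)%N) //; lia.
Qed.

End CombReturn.

(** * Horizontal displacement *)

Section Displacement.
Context {R : realType}.
Variable H : nat -> nat.
Hypothesis H_mono : {homo H : m n / (m <= n)%N}.

Let e := comb H.
Let e_sym : symmetric e := comb_sym H.
Let e_fin : forall v, finite_set (nbhd e v) := @comb_fin H.
Let deg_vertex : forall v, vertex H v -> (0 < degree e v)%N := @degree_vertex R H.

Definition radial (f : nat -> R) (v : int * int) : R := f `|v.1|%N.

(** The distance to the origin of the neighbour of a base point on the side of
    the origin; both neighbours of the origin itself are at distance one. *)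
Definition refl_pred (a : nat) : nat := if a is a'.+1 then a' else 1.

Lemma radial_pm f m : radial f (m + 1, 0) + radial f (m - 1, 0) =
  f `|m|.+1 + f (refl_pred `|m|).
Proof.
rewrite /radial /=; case: m => [[|n]|n].
- by rewrite add0r sub0r.
- rewrite (_ : absz (n.+1%:Z + 1) = n.+2) //; last by lia.
  by rewrite (_ : absz (n.+1%:Z - 1) = n) //; lia.
- rewrite (_ : absz (Negz n + 1) = n) //; last by lia.
  by rewrite (_ : absz (Negz n - 1) = n.+2); [rewrite addrC|lia].
Qed.

Lemma drift_radial_base f m : avg e (radial f) (m, 0) - radial f (m, 0) =
  (f `|m|.+1 + f (refl_pred `|m|) - 2 * f `|m|%N) / (2 + (0 < H `|m|)%:R).
Proof.
have d0 : 2 + (0 < H `|m|)%:R != 0 :> R by rewrite gt_eqF // ltr_pwDl.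
have := avgE e (radial f) (m, 0); rewrite degree_base base_sum radial_pm => E.
apply: (mulfI d0); rewrite mulrBr E /radial /=; field.
exact: d0.
Qed.

Lemma drift_radial_tooth f m (j : nat) : (j < H `|m|)%N ->
  avg e (radial f) (m, j.+1%:Z) - radial f (m, j.+1%:Z) = 0.
Proof.
move=> jH; have d0 : (j.+1 < H `|m|)%:R + 1 != 0 :> R by rewrite gt_eqF // ltr_wpDl.
have := avgE e (radial f) (m, j.+1%:Z); rewrite degree_tooth // tooth_sum // => E.
by apply: (mulfI d0); rewrite mulrBr E /radial /=; ring.
Qed.

Definition base (v : int * int) : R := (v.2 == 0)%:R.

Definition sq_dist : int * int -> R := radial (fun a => a%:R ^+ 2).

Lemma drift_sq_dist v : vertex H v -> avg e sq_dist v - sq_dist v <= base v.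
Proof.
case/vertexP => m [[|j] [-> jH]]; last by rewrite drift_radial_tooth.
rewrite drift_radial_base /base /= (_ : _ - _ = 2); last first.
  by case: `|m|%N => [|a] /=; rewrite -?natr1; ring.
by rewrite ler_pdivrMr ?ltr_pwDl // mul1r lerDl.
Qed.

(** On a tooth this function has drift [-1]; at its foot the drift is about two
    thirds of its height.  Hence the time spent on the base is smaller than the
    total time by a factor comparable with the height of the teeth. *)
Definition tooth_clock (v : int * int) : R :=
  `|v.2|%N%:R * (2 * (H `|v.1|)%:R - `|v.2|%N%:R).

Lemma drift_tooth_clock v : vertex H v ->
  base v * (2 * H `|v.1|).-1%:R <= 3 * (avg e tooth_clock v - tooth_clock v + 1 - base v).
Proof.
case/vertexP => m [[|j] [-> jH]]; rewrite /base /=.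
  have := avgE e tooth_clock (m, 0); rewrite degree_base base_sum /tooth_clock /= => E.
  case: posnP E => [->|h0] /=; rewrite !mul0r ?addr0 ?add0r ?mul1r => E; first by lra.
  have -> : (2 * H `|m|).-1%:R = 2 * (H `|m|)%:R - 1 :> R.
    by rewrite -subn1 natrB ?natrM //; lia.
  move: E; lra.
have := avgE e tooth_clock (m, j.+1%:Z); rewrite degree_tooth // tooth_sum //.
rewrite /tooth_clock /= mul0r subr0 -!natr1.
have [jj|jj] := ltnP j.+1 (H `|m|) => /= E; first by move: E; lra.
have hE : (H `|m|)%:R = j.+1%:R :> R by congr (_%:R); lia.
by move: E; rewrite hE -natr1 /=; lra.
Qed.

Definition parabola (r : nat) : int * int -> R := radial (fun a =>
  if (a <= r)%N then a%:R ^+ 2 else 2 * r%:R * a%:R - r%:R ^+ 2).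

(** This function of the distance to the origin is convex, and strictly so within
    distance [r]; its drift counts the time spent on the base near the origin,
    where the teeth may be short. *)
Lemma drift_parabola r v : (0 < r)%N -> vertex H v ->
  base v * (`|v.1| < r)%N%:R <= 3 / 2 * (avg e (parabola r) v - parabola r v).
Proof.
move=> r0 /vertexP [m [[|j] [-> jH]]]; last by rewrite drift_radial_tooth // mulr0 mul0r.
rewrite drift_radial_base /base /= mul1r; set D := _ - 2 * _.
have [D2 D0] : 2 * (`|m| < r)%N%:R <= D /\ 0 <= D.
  rewrite /D; case: `|m|%N => [|a] /=.
    by rewrite r0 /= expr0n /=; split; lra.
  rewrite -!natr1.
  have [ar|ra|arE] := ltngtP a.+1 r.
  - by rewrite (ltnW (ltnW ar)) /=; split; lra.
  - case: leqP => ar /=; last by split; lra.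
    have -> : r = a by lia.
    by split; lra.
  - by rewrite -arE leqnSn /= -?natr1; split; lra.
have [h1 h3] : 1 <= 2 + (0 < H `|m|)%:R :> R /\ 2 + (0 < H `|m|)%:R <= 3 :> R.
  by case: (0 < _)%N => /=; split; lra.
rewrite mulrA ler_pdivlMr; last by lra.
apply: (@le_trans _ _ ((`|m| < r)%N%:R * 3)); first by rewrite ler_wpM2l.
lra.
Qed.

Lemma parabola_le r s v : (0 < s)%N ->
  parabola r v <= r%:R * (sq_dist v / s%:R + s%:R).
Proof.
move=> s0; have {}s0 : 0 < s%:R :> R by rewrite ltr0n.
rewrite /parabola /sq_dist /radial; move: `|v.1|%N => a.
have r0 : 0 <= r%:R :> R by [].
apply: (@le_trans _ _ (r%:R * (2 * a%:R))).
  case: leqP => ar; last by have := sqr_ge0 (r%:R : R); lra.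
  have : a%:R <= r%:R :> R by rewrite ler_nat.
  have : 0 <= a%:R :> R by []. nra.
rewrite ler_wpM2l // -(ler_pM2r s0) [leRHS]mulrDl divfK ?gt_eqF //.
by have := sqr_ge0 (a%:R - s%:R : R); lra.
Qed.

Lemma parabola_ge0 r v : 0 <= parabola r v.
Proof.
rewrite /parabola /radial; case: leqP => [_|ra]; first exact: sqr_ge0.
have : r%:R <= `|v.1|%N%:R :> R by rewrite ler_nat ltnW.
have : 0 <= r%:R :> R by []. nra.
Qed.

Lemma iter_avg_vertex n (f g : int * int -> R) u : vertex H u ->
  (forall v, vertex H v -> f v <= g v) -> iter n (avg e) f u <= iter n (avg e) g u.
Proof.
move=> vu fg; apply: (iter_avg_le e_fin (I := fun _ => vertex H)) => // k y z _.
exact: vertex_comb.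
Qed.

Lemma iter_avg_region n (f : int * int -> R) c u : vertex H u ->
  (forall v, vertex H v -> (`|v.1| <= `|u.1| + n)%N -> f v <= c) ->
  iter n (avg e) f u <= c.
Proof.
move=> vu fc; rewrite -[leRHS](iter_avg_cst e_sym e_fin n c (deg_vertex vu)).
apply: (iter_avg_le e_fin (I := fun k v => vertex H v /\ (`|v.1| + k <= `|u.1| + n)%N)).
- move=> k y z [_ yk] yz; split; first exact: vertex_comb yz.
  by move: yk (comb_fst yz); move: (absz z.1) (absz y.1) (absz u.1) => z1 y1 u1; lia.
- by split.
- by move=> y [vy]; rewrite addn0; apply: fc.
Qed.

Lemma sq_dist_crude n u : vertex H u -> iter n (avg e) sq_dist u <= sq_dist u + n%:R.
Proof.
move=> vu; rewrite iter_avg_drift // lerD2l.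
rewrite -[n in n%:R]card_ord -sum1_card natr_sum; apply: ler_sum => k _.
rewrite -[leRHS](iter_avg_cst e_sym e_fin k 1 (deg_vertex vu)).
apply: iter_avg_vertex => // v /drift_sq_dist/le_trans; apply.
by rewrite /base; case: (_ == _).
Qed.

(** The drift of [sq_dist] is at most the indicator of the base.  The time spent on
    the base is controlled by [tooth_clock] beyond distance [r] of the origin, and
    by [parabola r] within; [s] comes from [2 |m| <= m ^ 2 / s + s]. *)
Lemma sq_dist_le n (r s : nat) u : vertex H u -> (0 < r)%N -> (0 < s)%N -> (0 < H r)%N ->
  iter n (avg e) sq_dist u <= sq_dist u +
    (6 / (H r).+1%:R * (n%:R + (H (`|u.1| + n)%N)%:R ^+ 2) +
     3 / 2 * (r%:R * ((sq_dist u + n%:R) / s%:R + s%:R))).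
Proof.
move=> vu r0 s0 Hr0; rewrite iter_avg_drift // lerD2l.
set c1 := 6 / _; set c2 := 3 / 2.
have c1_0 : 0 <= c1 by rewrite divr_ge0.
pose g v := c1 * (avg e tooth_clock v - tooth_clock v + 1) +
            c2 * (avg e (parabola r) v - parabola r v).
have base_le v : vertex H v -> base v <= g v.
  move=> vv; have hc := drift_tooth_clock vv; have hp := drift_parabola r0 vv.
  have b0 : 0 <= base v <= 1 by rewrite /base; case: (_ == _); rewrite ?ler01 ?lexx.
  have {}hc : base v * (2 * H `|v.1|).-1%:R <=
      3 * (avg e tooth_clock v - tooth_clock v + 1) by move: hc b0; lra.
  rewrite /g; set x := _ + 1 in hc *.
  have cx : c1 * x = 2 / (H r).+1%:R * (3 * x) by rewrite /c1; field.
  have hcx : 2 / (H r).+1%:R * (base v * (2 * H `|v.1|).-1%:R) <= c1 * x.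
    by rewrite cx ler_wpM2l // divr_ge0.
  have [near|far] := ltnP `|v.1| r.
    move: hp; rewrite near mulr1 => hp; apply: le_trans hp _; rewrite lerDr.
    by apply: le_trans hcx; rewrite mulr_ge0 ?divr_ge0 // mulr_ge0 //; case/andP: b0.
  move: hp; rewrite ltnNge far mulr0 => hp.
  apply: (@le_trans _ _ (c1 * x)); last by rewrite lerDl.
  apply: le_trans hcx; rewrite mulrCA; case/andP: b0 => b0 _.
  rewrite ler_peMr // mulrAC ler_pdivlMr ?ltr0n // mul1r -natrM ler_nat.
  by have := H_mono far; lia.
apply: (@le_trans _ _ (\sum_(k < n) iter k (avg e) g u)).
  apply: ler_sum => k _; apply: iter_avg_vertex => // v vv.
  exact: le_trans (drift_sq_dist vv) (base_le v vv).
have sumE : \sum_(k < n) iter k (avg e) g u =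
    c1 * (iter n (avg e) tooth_clock u - tooth_clock u + n%:R) +
    c2 * (iter n (avg e) (parabola r) u - parabola r u).
  rewrite (iter_avg_drift e_fin n tooth_clock) (iter_avg_drift e_fin n (parabola r)).
  rewrite !(addrC (_ u)) !addrK.
  rewrite -[n in n%:R]card_ord -sum1_card natr_sum -big_split !big_distrr -big_split /=.
  apply: eq_bigr => k _; rewrite /g iter_avgD // !iter_avgZ //.
  by rewrite (iter_avgD _ _ _ (fun=> 1)) // iter_avg_cst // deg_vertex.
rewrite sumE lerD //.
  rewrite ler_wpM2l // (addrC n%:R) lerD2r.
  apply: (@le_trans _ _ (iter n (avg e) tooth_clock u)).
    rewrite gerBl; case/vertexP: vu => m [j [-> jH]]; rewrite /tooth_clock /=.
    have : j%:R <= (H `|m|)%:R :> R by rewrite ler_nat.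
    by move=> jh; rewrite mulr_ge0 //; have : 0 <= j%:R :> R by []; lra.
  apply: iter_avg_region => // v vv vn; rewrite /tooth_clock.
  have : (H `|v.1|)%:R <= (H (`|u.1| + n)%N)%:R :> R by rewrite ler_nat H_mono.
  move: `|v.2|%N%:R => j; move: (H `|v.1|)%:R (ler0n R (H `|v.1|)) => h h0 hh.
  by have := sqr_ge0 (j - h); nra.
rewrite ler_wpM2l ?divr_ge0 //.
apply: (@le_trans _ _ (iter n (avg e) (parabola r) u)); first by rewrite gerBl parabola_ge0.
apply: (@le_trans _ _ (iter n (avg e) (fun v => r%:R * (s%:R^-1 * sq_dist v + s%:R)) u)).
  by apply: iter_avg_vertex => // v _; rewrite mulrC mulrC (mulrC s%:R^-1) parabola_le.
rewrite iter_avgZ // (iter_avgD _ _ _ (fun=> s%:R)) // iter_avgZ // iter_avg_cst ?deg_vertex //.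
rewrite ler_wpM2l // lerD2r mulrC ler_wpM2r ?invr_ge0 //.
exact: sq_dist_crude.
Qed.

End Displacement.

(** * Lower bound for the expected number of collisions *)

Section Lower.
Context {R : realType}.
Variable H : nat -> nat.
Hypothesis H_mono : {homo H : m n / (m <= n)%N}.
Hypothesis H_quart : forall m, ((H (m ^ 4)).+1 <= 4 * (H m).+1)%N.
Hypothesis H_sqr : forall m, (H m ^ 2 <= m)%N.
Hypothesis H_exp2 : forall k, (H (2 ^ k) <= k)%N.
Hypothesis H_4 : (0 < H 4)%N.

Let e := comb H.
Let e_sym : symmetric e := comb_sym H.
Let e_fin : forall v, finite_set (nbhd e v) := @comb_fin H.
Let e_deg : forall v, (degree e v <= 3)%N := @degree_le3 R H.
Let deg_vertex : forall v, vertex H v -> (0 < degree e v)%N := @degree_vertex R H.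

(** Scale [j] stands for distances of order [16 ^ j] and times of order
    [scale_time j].  The number of points of a tooth is taken at distance [2 ^ j];
    as the heights grow slowly, it is the same, up to a factor, at distance
    [16 ^ j], and the walk spends little time within distance [2 ^ j]. *)
Definition tooth_size (j : nat) : nat := (H (2 ^ j)).+1.
Definition scale_time (j : nat) : nat := 16 ^ j * 16 ^ j * tooth_size j.

Lemma scale_timeE j : scale_time j = (16 ^ j * 16 ^ j * tooth_size j)%N.
Proof. by []. Qed.

Lemma tooth_size_gt0 j : (0 < tooth_size j)%N. Proof. exact: ltn0Sn. Qed.

Lemma tooth_size_mono i j : (i <= j)%N -> (tooth_size i <= tooth_size j)%N.
Proof. by move=> ij; rewrite ltnS H_mono // leq_pexp2l. Qed.

Lemma tooth_size_le j : (tooth_size j <= j.+1)%N. Proof. by rewrite ltnS. Qed.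

Lemma tooth_size_quart j : (tooth_size (4 * j) <= 4 * tooth_size j)%N.
Proof. by rewrite /tooth_size mulnC expnM. Qed.

Lemma tooth_sizeS j : (0 < j)%N -> (tooth_size j.+1 <= 4 * tooth_size j)%N.
Proof. by move=> j0; apply: leq_trans (tooth_size_quart j); apply: tooth_size_mono; move: j0; clear; lia. Qed.

Lemma exp2_gt j : (j < 2 ^ j)%N. Proof. exact: ltn_expl. Qed.

Lemma exp16E j : (16 ^ j = (2 ^ j) ^ 4)%N.
Proof. by rewrite -expnM mulnC expnM. Qed.

Lemma exp2_le16 j : (2 ^ j <= 16 ^ j)%N.
Proof. by rewrite exp16E -[leqLHS]expn1 leq_pexp2l ?expn_gt0. Qed.

(** The bound on the displacement for [r = 2 ^ j] and [s = 16 ^ j * tooth_size j],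
    with [x = 2 ^ j], [h = tooth_size j] and a starting point at distance [d]. *)
Lemma sq_dist_scale_ineq (x h d n m : R) :
    4 <= x -> 1 <= h -> h <= x -> 0 <= d -> 6 * d <= x -> 0 <= n ->
    n <= 4 * (x ^+ 4 * x ^+ 4 * h) -> m <= d + 4 * (x ^+ 4 * x ^+ 4 * h) ->
  d ^+ 2 + (6 / h * (n + m) +
    3 / 2 * (x * ((d ^+ 2 + n) / (x ^+ 4 * h) + x ^+ 4 * h))) <= 51 * (x ^+ 4) ^+ 2.
Proof.
move=> x4 h1 hx d0 dx n0 nle mle.
have x0 : 0 < x by lra.
have h0 : 0 < h by lra.
have [r rE] : exists r, r = x ^+ 4 by eexists.
have x2 : 16 <= x ^+ 2 by nra.
have rx2 : 16 * x ^+ 2 <= r by rewrite rE (_ : 4 = 2 + 2)%N // exprD; nra.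
have r0 : 0 < r by lra.
have xx : 4 * x <= x ^+ 2 by nra.
rewrite -rE in nle mle *.
have ha : d ^+ 2 <= r.
  by apply: (@le_trans _ _ (x ^+ 2)); [nra | lra].
have rr : 16 * r <= r ^+ 2 by nra.
have hb : 6 / h * (n + m) <= 49 * r ^+ 2.
  rewrite mulrAC ler_pdivrMr //.
  have dr : 6 * d <= r ^+ 2 * h by nra.
  by move: nle mle; nra.
have hc : (d ^+ 2 + n) / (r * h) <= 5 * r.
  rewrite ler_pdivrMr ?mulr_gt0 //.
  have : d ^+ 2 <= r * (r * h) by nra.
  by move: nle; nra.
have hd : x * (5 * r + r * h) <= r * (3 * x ^+ 2).
  have xh : x * h <= x ^+ 2 by rewrite expr2 ler_pM2l.
  rewrite (_ : x * _ = r * (5 * x + x * h)); last by ring.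
  by rewrite ler_pM2l //; lra.
have he : 3 / 2 * (x * ((d ^+ 2 + n) / (r * h) + r * h)) <= r ^+ 2.
  apply: (@le_trans _ _ (3 / 2 * (x * (5 * r + r * h)))).
    by rewrite ler_pM2l // ler_pM2l // lerD2r.
  have : r * (3 * x ^+ 2 + 2 * x ^+ 2) <= r * r by rewrite ler_pM2l //; lra.
  have : 0 <= r * x ^+ 2 by rewrite mulr_ge0 ?sqr_ge0 // ltW.
  by lra.
lra.
Qed.

(** The displacement is diffusive with respect to the time spent on the base,
    which is a fraction of the order of [1 / tooth_size j] of the total. *)
Lemma sq_dist_scale u : vertex H u -> exists j0, forall j t, (j0 <= j)%N ->
  (t <= 4 * scale_time j)%N -> iter t (avg e) sq_dist u <= 51 * (16 ^ j)%:R ^+ 2 :> R.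
Proof.
move=> vu; set d := absz u.1; exists (6 * d + 2)%N => j t dj tt.
have x4 : (4 <= 2 ^ j)%N by rewrite (leq_trans (_ : 4 <= 2 ^ 2)%N) // leq_pexp2l //; lia.
have Hx : (0 < H (2 ^ j))%N by apply: leq_trans (H_mono x4).
have s0 : (0 < 16 ^ j * tooth_size j)%N by rewrite muln_gt0 expn_gt0.
have := sq_dist_le (R := R) H_mono t vu (expn_gt0 2 j : (0 < 2 ^ j)%N) s0 Hx.
move=> /le_trans; apply.
rewrite -/d -/(tooth_size j) natrM exp16E (natrX _ (2 ^ j) 4) [sq_dist u](_ : _ = d%:R ^+ 2) //.
have tE : (scale_time j)%:R = (2 ^ j)%:R ^+ 4 * (2 ^ j)%:R ^+ 4 * (tooth_size j)%:R :> R.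
  by rewrite /scale_time !natrM exp16E (natrX _ (2 ^ j) 4).
apply: sq_dist_scale_ineq; rewrite -?tE -?natrM ?ler_nat ?(ler_nat R 4) ?ler1n //.
- exact: leq_trans (tooth_size_le j) (exp2_gt j).
- have := exp2_gt j; lia.
- rewrite -natrX -natrD ler_nat; apply: leq_trans (H_sqr _) _; rewrite leq_add2l //.
Qed.

Definition box (a : nat) : seq (int * int) :=
  [seq (k%:Z - a%:Z, i%:Z) | k <- iota 0 (2 * a).+1, i <- iota 0 (H a).+1].

Lemma size_box a : size (box a) = ((2 * a).+1 * (H a).+1)%N.
Proof. by rewrite size_allpairs !size_iota. Qed.

Lemma uniq_box a : uniq (box a).
Proof.
apply: allpairs_uniq; rewrite ?iota_uniq //.
by move=> [k i] [k' i'] _ _ /= [h1 h2]; congr pair; lia.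
Qed.

Lemma mem_box a v : vertex H v -> (absz v.1 <= a)%N -> v \in box a.
Proof.
case/vertexP => m [j [-> jH]] /= ma; apply/allpairsP.
exists (absz (m + a%:Z), j); rewrite !mem_iota /=; split; first by lia.
  by have := H_mono ma; lia.
by congr pair; lia.
Qed.

(** Chebyshev. *)
Lemma box_mass u t a : vertex H u -> (0 < a)%N ->
    iter t (avg e) sq_dist u <= a%:R ^+ 2 / 2 :> R ->
  1 / 2 <= iter t (avg e) (fun y => (y \in box a)%:R) u :> R.
Proof.
move=> vu a0 ua; have a2 : 0 < a%:R ^+ 2 :> R by rewrite exprn_gt0 // ltr0n.
apply: (@le_trans _ _ (iter t (avg e) (fun y => 1 + (- (a%:R ^- 2)) * sq_dist y) u)).
  rewrite iter_avgD // iter_avgZ // iter_avg_cst ?deg_vertex // mulNr.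
  have : a%:R ^- 2 * iter t (avg e) sq_dist u <= 1 / 2 :> R.
    by rewrite mulrC ler_pdivrMr //; move: ua; lra.
  lra.
apply: iter_avg_vertex => // v vv; have [va|va] := leqP (absz v.1) a.
  rewrite mem_box //= mulNr gerBl mulr_ge0 ?invr_ge0 ?(ltW a2) //.
  by rewrite /sq_dist /radial sqr_ge0.
apply: (@le_trans _ _ 0) => //; rewrite mulNr subr_le0 mulrC ler_pdivlMr // mul1r.
by rewrite /sq_dist /radial lerXn2r ?nnegrE // ler_nat ltnW.
Qed.

Lemma box_scale j : (0 < j)%N ->
  (size (box (11 * 16 ^ j)) <= 368 * (16 ^ j * tooth_size j))%N.
Proof.
move=> j0; rewrite size_box.
have hH : ((H (11 * 16 ^ j)).+1 <= 16 * tooth_size j)%N.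
  have up : (11 * 16 ^ j <= 2 ^ (4 * j.+1))%N by rewrite expnM expnS leq_mul2r orbT.
  apply: (@leq_trans (tooth_size (4 * j.+1))); first by rewrite ltnS H_mono.
  apply: leq_trans (tooth_size_quart _) _; rewrite (_ : 16 = 4 * 4)%N // -mulnA leq_mul2l.
  by rewrite tooth_sizeS.
have r1 : (0 < 16 ^ j)%N by rewrite expn_gt0.
rewrite (_ : 368 * _ = (23 * 16 ^ j) * (16 * tooth_size j))%N; last by lia.
by apply: leq_mul => //; lia.
Qed.

(** Locked, lest unification should compute with the numerals. *)
Definition c_hit : R := locked (8 * 3 * 368)^-1.

Lemma c_hit_gt0 : 0 < c_hit.
Proof. by rewrite /c_hit -lock invr_gt0 -!natrM ltr0n. Qed.

(** At times of scale [j] the walk is in a box of size of the order of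
    [16 ^ j * tooth_size j] with probability one half, and it is spread evenly over
    the vicinity of its starting point. *)
Lemma hit2_scale u : vertex H u -> exists j0, forall j t x, (j0 <= j)%N ->
    (scale_time j <= t <= 4 * scale_time j)%N -> dist_le e (16 ^ (j - 6)) u x ->
  c_hit / (16 ^ j * tooth_size j)%:R <= hit2 e t.*2 u x :> R.
Proof.
move=> vu; have [j0 Hj0] := sq_dist_scale vu; exists (j0 + 6)%N => j t x jj /andP[t1 t2] ux.
set b := (368 * (16 ^ j * tooth_size j))%N.
have r1 : (0 < 16 ^ j)%N by rewrite expn_gt0.
have b0 : (0 < b)%N by rewrite !muln_gt0 r1.
have a0 : (0 < 11 * 16 ^ j)%N by rewrite muln_gt0.
have half : 1 / 2 <= iter t (avg e) (fun y => (y \in box (11 * 16 ^ j))%:R) u :> R.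
  apply: box_mass => //; apply: le_trans (Hj0 j t _ t2) _; first by lia.
  by rewrite natrM; have := sqr_ge0 ((16 ^ j)%:R : R); lra.
have s0 : (0 < size (box (11 * 16 ^ j)))%N by rewrite size_box.
have lo := return_ge e_sym e_fin e_deg (deg_vertex vu) (uniq_box _) s0 half.
have -> : c_hit / (16 ^ j * tooth_size j)%:R = 1 / (8 * 3 * b%:R).
  rewrite /b (natrM _ 368) /c_hit -lock; move: (16 ^ j * tooth_size j)%:R => z.
  by rewrite mul1r (mulrA (8 * 3)) -invfM.
apply: (hit2_ge e_sym e_fin e_deg (deg_vertex vu) b0 ux).
  rewrite -addnn; apply: le_trans lo; rewrite !mul1r lef_pV2 ?posrE; last 2 first.
  - by rewrite !mulr_gt0 // ltr0n.
  - by rewrite !mulr_gt0 // ltr0n.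
  by rewrite ler_pM2l ?ler_nat ?box_scale // ?mulr_gt0 //; lia.
apply: leq_trans t1; rewrite /scale_time /b.
have -> : (16 ^ j = 16 ^ 3 * (16 ^ 3 * 16 ^ (j - 6)))%N.
  by rewrite -!expnD; congr (_ ^ _)%N; lia.
move: (16 ^ (j - 6))%N (tooth_size j) => q h; move: (isT : (288 <= 16 ^ 3)%N) (isT : (368 <= 16 ^ 3)%N).
move: (16 ^ 3)%N => C C1 C2.
rewrite (_ : 32 * 3 ^ 2 = 288)%N //.
rewrite (_ : 288 * _ * q = (288 * 368) * (C * (C * q) * h * q))%N; last by lia.
rewrite (_ : C * (C * q) * (C * (C * q)) * h = (C * C) * (C * (C * q) * h * q))%N; last by lia.
by apply: leq_mul => //; apply: leq_mul.
Qed.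

(** A part of the comb that is close enough to any given starting point for the
    previous bound when [j] is large, and far enough from the origin for its teeth
    to have [tooth_size j] points. *)
Definition patch (j : nat) : seq (int * int) :=
  [seq ((16 ^ (j - 7) + k)%N%:Z, i%:Z) | k <- iota 0 (16 ^ (j - 7)), i <- iota 0 (tooth_size j)].

Lemma size_patch j : size (patch j) = (16 ^ (j - 7) * tooth_size j)%N.
Proof. by rewrite size_allpairs !size_iota. Qed.

Lemma uniq_patch j : uniq (patch j).
Proof.
apply: allpairs_uniq; rewrite ?iota_uniq //.
by move=> [k i] [k' i'] _ _ /= [h1 h2]; congr pair; lia.
Qed.

Lemma patchP u : vertex H u -> exists j0, forall j x, (j0 <= j)%N -> x \in patch j ->
  vertex H x /\ dist_le e (16 ^ (j - 6)) u x.
Proof.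
move=> /vertexP[m [b [-> bH]]]; exists (b + absz m + 10)%N => j x jj.
case/allpairsP => -[k i] []; rewrite !mem_iota !add0n.
move=> /andP[_ kq] /andP[_ ij] -> /=; change (is_true (k < 16 ^ (j - 7))%N) in kq.
change (is_true (i < tooth_size j)%N) in ij.
have qE : (16 ^ (j - 6) = 16 * 16 ^ (j - 7))%N by rewrite -expnS; congr (_ ^ _)%N; lia.
have q2 : (2 ^ j <= 16 ^ (j - 7))%N.
  by rewrite (_ : 16 = 2 ^ 4)%N // -expnM leq_exp2l //; lia.
have jq := leq_trans (exp2_gt j) q2.
have iH : (i <= H (absz (16 ^ (j - 7) + k)%N%:Z))%N.
  by rewrite -ltnS; apply: leq_trans ij _; rewrite ltnS H_mono //= (leq_trans q2) ?leq_addr.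
split; first by apply/vertexP; exists (16 ^ (j - 7) + k)%N%:Z, i.
apply: (dist_le_comb bH iH); rewrite qE.
have := leq_trans ij (tooth_size_le j); move: kq jq; move: (16 ^ (j - 7))%N => q; lia.
Qed.

Definition c_coll : R := locked (c_hit ^+ 3 / (27 * 16 ^+ 7)).

Lemma c_coll_gt0 : 0 < c_coll.
Proof.
by rewrite /c_coll -lock divr_gt0 ?exprn_gt0 ?c_hit_gt0 //.
Qed.

(** At times of scale [j] the three walks are spread evenly enough over [patch j]
    to meet with probability of the order of the inverse square of its size. *)
Lemma coll_scale u v w : vertex H u -> vertex H v -> vertex H w ->
    colour v = colour u -> colour w = colour u ->
  exists j0, forall j t, (j0 <= j)%N -> (scale_time j <= t <= 4 * scale_time j)%N ->
    c_coll / ((16 ^ j)%:R * (tooth_size j)%:R) ^+ 2 <= coll e t.*2 u v w + coll e t.*2.+1 u v w.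
Proof.
move=> vu vv vw cv cw.
have [j1 h1] := hit2_scale vu; have [j2 h2] := hit2_scale vv; have [j3 h3] := hit2_scale vw.
have [k1 p1] := patchP vu; have [k2 p2] := patchP vv; have [k3 p3] := patchP vw.
exists (j1 + j2 + j3 + k1 + k2 + k3 + 7)%N => j t jj tj.
have [[J1 J2 J3] [K1 K2 K3] j7] : [/\ [/\ j1 <= j, j2 <= j & j3 <= j],
    [/\ k1 <= j, k2 <= j & k3 <= j] & 7 <= j]%N.
  by split; [split|split|]; move: jj; clear; lia.
have := @coll2_ge R _ e e_sym e_fin 3 e_deg colour (@comb_colour H) t.*2 u v w (patch j).
move=> /(_ (deg_vertex vu) (deg_vertex vv) (deg_vertex vw) cv cw (uniq_patch j)).
have pdeg x : x \in patch j -> (0 < degree e x)%N.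
  by move=> xp; apply: deg_vertex; exact: (p1 j x K1 xp).1.
move=> /(_ pdeg); apply: le_trans; rewrite ler_pdivlMr ?exprn_gt0 //.
set g : R := c_hit / (16 ^ j * tooth_size j)%:R.
have b0 : 0 < (16 ^ j * tooth_size j)%:R :> R by rewrite ltr0n muln_gt0 expn_gt0.
have g0 : 0 <= g by rewrite divr_ge0 // ltW // c_hit_gt0.
apply: (@le_trans _ _ (\sum_(x <- patch j) g ^+ 3)); last first.
  rewrite big_seq [leRHS]big_seq; apply: ler_sum => x xp.
  have h1x : g <= hit2 e t.*2 u x by exact: h1 j t x J1 tj (p1 j x K1 xp).2.
  have h2x : g <= hit2 e t.*2 v x by exact: h2 j t x J2 tj (p2 j x K2 xp).2.
  have h3x : g <= hit2 e t.*2 w x by exact: h3 j t x J3 tj (p3 j x K3 xp).2.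
  move: (hit2 e _ u x) (hit2 e _ v x) (hit2 e _ w x) h1x h2x h3x => a b c ga gb gc.
  rewrite (_ : g ^+ 3 = g * g * g); last by rewrite exprS expr2 mulrA.
  have gg : g * g <= a * b by apply: ler_pM.
  by apply: ler_pM => //; apply: mulr_ge0.
rewrite big_const_seq count_predT iter_addr_0 size_patch -[leRHS]mulr_natl.
have RE : (16 ^ j)%:R = 16 ^+ 7 * (16 ^ (j - 7))%:R :> R.
  by rewrite -natrX -natrM -expnD; congr (_ ^ _)%:R; move: j7; clear; lia.
rewrite /g !natrM RE /c_coll -lock; move: c_hit => c.
have q0 : (16 ^ (j - 7))%:R != 0 :> R by rewrite pnatr_eq0 -lt0n expn_gt0.
have e0 : (tooth_size j)%:R != 0 :> R by rewrite pnatr_eq0.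
rewrite le_eqVlt; apply/orP; left; apply/eqP.
by field; rewrite q0 e0.
Qed.

Lemma sum_pairs (F : nat -> R) a b : (a <= b)%N ->
  \sum_(a.*2 <= k < b.*2) F k = \sum_(a <= t < b) (F t.*2 + F t.*2.+1).
Proof.
move=> /subnKC <-; elim: (b - a)%N => [|n IHn]; first by rewrite addn0 !big_geq.
rewrite addnS doubleS !big_nat_recr ?leq_addr //=; last 2 first.
- by rewrite leq_double leq_addr.
- by rewrite leqW // leq_double leq_addr.
by rewrite IHn addrA.
Qed.

Lemma scale_timeS j : (2 * scale_time j <= scale_time j.+1)%N.
Proof.
rewrite /scale_time !expnS (_ : 16 * _ * _ * _ = 256 * (16 ^ j * 16 ^ j * tooth_size j.+1))%N; last by clear; lia.
by apply: leq_mul => //; rewrite leq_mul2l tooth_size_mono ?orbT.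
Qed.

Lemma scale_time_gt0 j : (0 < scale_time j)%N.
Proof. by rewrite !muln_gt0 expn_gt0. Qed.

(** The times [2 * scale_time j <= k < 4 * scale_time j] contribute a multiple of
    [1 / tooth_size j], and these windows are disjoint. *)
Lemma hits_lower u v w : vertex H u -> vertex H v -> vertex H w ->
    colour v = colour u -> colour w = colour u ->
  exists j0, forall J N, (4 * scale_time J <= N)%N ->
    c_coll * \sum_(j0 <= j < J.+1) ((tooth_size j)%:R)^-1 <= hits (triple e) meet N (u, v, w).
Proof.
move=> vu vv vw cv cw; have [j0 Hj0] := coll_scale vu vv vw cv cw; exists j0 => J N JN.
have window j : (j0 <= j)%N -> c_coll / (tooth_size j)%:R <=
    \sum_((2 * scale_time j) <= k < 4 * scale_time j) coll e k u v w.
  move=> jj; rewrite (_ : 4 * scale_time j = (2 * scale_time j).*2)%N; last by lia.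
  rewrite mul2n sum_pairs; last by lia.
  apply: (@le_trans _ _ (\sum_(scale_time j <= t < (scale_time j).*2)
      c_coll / ((16 ^ j)%:R * (tooth_size j)%:R) ^+ 2)).
    rewrite sumr_const_nat (_ : (scale_time j).*2 - scale_time j = scale_time j)%N; last by lia.
    rewrite -[leRHS]mulr_natl /scale_time !natrM le_eqVlt; apply/orP; left; apply/eqP.
    have q0 : (16 ^ j)%:R != 0 :> R by rewrite pnatr_eq0 -lt0n expn_gt0.
    have e0 : (tooth_size j)%:R != 0 :> R by rewrite pnatr_eq0.
    by field; rewrite q0 e0.
  rewrite big_nat [leRHS]big_nat; apply: ler_sum => t tt; apply: Hj0 => //; lia.
have claim K : c_coll * \sum_(j0 <= j < K.+1) ((tooth_size j)%:R)^-1 <=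
    \sum_(1 <= k < 4 * scale_time K) coll e k u v w.
  have step K' : c_coll * \sum_(j0 <= j < K') ((tooth_size j)%:R)^-1 <=
        \sum_(1 <= k < 2 * scale_time K') coll e k u v w ->
      c_coll * \sum_(j0 <= j < K'.+1) ((tooth_size j)%:R)^-1 <=
        \sum_(1 <= k < 4 * scale_time K') coll e k u v w.
    move=> IH; rewrite [leRHS](@big_cat_nat _ _ _ (2 * scale_time K')%N) /=; try by have := scale_time_gt0 K'; lia.
    have [jK|Kj] := leqP j0 K'.
      by rewrite big_nat_recr //= mulrDr lerD // window.
    rewrite big_geq // mulr0 addr_ge0 // sumr_ge0 // => k _; exact: coll_ge0.
  elim: K => [|K IHK].
    apply: step; rewrite big_geq // mulr0 sumr_ge0 // => k _; exact: coll_ge0.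
  apply: step; apply: le_trans IHK _.
  rewrite [leRHS](@big_cat_nat _ _ _ (4 * scale_time K)%N) /=; last 2 first.
  - by have := scale_time_gt0 K; lia.
  - by have := scale_timeS K; lia.
  rewrite lerDl sumr_ge0 // => k _; exact: coll_ge0.
apply: le_trans (claim J) _; rewrite hits_meet // -(big_mkord predT (fun k => coll e k.+1 u v w)).
have t0 := scale_time_gt0 J.
rewrite big_add1 (_ : 4 * scale_time J = (4 * scale_time J).-1.+1)%N /=; last by lia.
rewrite [leRHS](@big_cat_nat _ _ _ (4 * scale_time J).-1) //=; last by lia.
by rewrite lerDl sumr_ge0 // => k _; exact: coll_ge0.
Qed.

End Lower.

(** * Upper bound for the expected number of collisions *)

Section Upper.
Context {R : realType}.
Variable H : nat -> nat.
Hypothesis H_mono : {homo H : m n / (m <= n)%N}.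
Hypothesis H_quart : forall m, ((H (m ^ 4)).+1 <= 4 * (H m).+1)%N.
Hypothesis H_exp2 : forall k, (H (2 ^ k) <= k)%N.

Let e := comb H.
Let e_sym : symmetric e := comb_sym H.
Let e_fin : forall v, finite_set (nbhd e v) := @comb_fin H.
Let e_deg : forall v, (degree e v <= 3)%N := @degree_le3 R H.
Let deg_vertex : forall v, vertex H v -> (0 < degree e v)%N := @degree_vertex R H.

Local Notation tooth_size := (tooth_size H).
Local Notation scale_time := (scale_time H).

Lemma coll_le_sup n v (b : R) : vertex H v ->
    (forall m (j : nat), (j <= H (absz m))%N -> (absz m <= absz v.1 + n.+1)%N ->
      hit2 e n./2.*2 (m, j%:Z) (m, j%:Z) <= b) ->
  coll e n v v v <= 9 * b ^+ 2.
Proof.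
move=> vv hb; rewrite (_ : 9 = 3%:R ^+ 2); last by rewrite -natrX.
apply: (coll_le e_sym e_fin e_deg (deg_vertex vv)) => y /(reach_comb vv)[].
by case/vertexP => m [j [-> jH]]; apply: hb.
Qed.

Lemma coll_le_line n v (r : nat) : vertex H v -> (0 < r)%N -> (48 * r * r <= n)%N ->
  coll e n v v v <= 1296 / r%:R ^+ 2 :> R.
Proof.
move=> vv r0 rn.
have -> : 1296 / r%:R ^+ 2 = 9 * (12 / r%:R) ^+ 2 :> R.
  by field; rewrite pnatr_eq0 -lt0n.
apply: coll_le_sup => // m j jH _.
apply: comb_return_line => //.
by rewrite geq_half_double; lia.
Qed.

Lemma coll_le_box n v (K j : nat) : vertex H v -> (absz v.1 + n.+1 <= 2 ^ K)%N ->
  (K <= 16 ^ j)%N -> (96 * scale_time j <= n)%N ->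
  coll e n v v v <= 1296 / (16 ^ j * tooth_size j)%:R ^+ 2 :> R.
Proof.
move=> vv vK Kj jn; have r0 : (0 < 16 ^ j)%N by rewrite expn_gt0.
have -> : 1296 / (16 ^ j * tooth_size j)%:R ^+ 2 = 9 * (12 / (16 ^ j * tooth_size j)%:R) ^+ 2 :> R.
  have : (16 ^ j * tooth_size j)%:R != 0 :> R by rewrite pnatr_eq0 -lt0n muln_gt0 r0 tooth_size_gt0.
  by move: (_ %:R) => z z0; field.
have je := exp2_le16 j.
apply: coll_le_sup => // m i iH mn.
apply: comb_return_box => //.
- by rewrite ltnS H_mono.
- have iK : (i <= K)%N.
    by apply: leq_trans iH _; apply: leq_trans (H_exp2 K); apply: H_mono; lia.
  have := tooth_size_le H_exp2 j; have := exp2_gt j; lia.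
- by rewrite geq_half_double; move: jn; rewrite scale_timeE; lia.
Qed.

Lemma coll_le_cst n v : vertex H v -> coll e n v v v <= 1296 :> R.
Proof.
move=> vv; apply: (@le_trans _ _ (9 * 2 ^+ 2)); last by lra.
apply: coll_le_sup => // m j jH _; rewrite (_ : 2 = 1 + 1) //.
have d0 : (0 < degree e (m, j%:Z))%N by apply: deg_vertex; apply/vertexP; exists m, j.
have le1 k : hitp e k (m, j%:Z) (m, j%:Z) <= 1 :> R.
  rewrite -(iter_avg_cst e_sym e_fin k 1 d0); apply: iter_avg_mono => // y.
  by case: (_ == _).
by rewrite /hit2 lerD.
Qed.

Lemma sum_block_le (F : nat -> R) c a b : 0 <= c ->
  (forall k, (a <= k)%N -> F k <= c) -> \sum_(a <= k < b) F k <= b%:R * c.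
Proof.
move=> c0 Fc; apply: (@le_trans _ _ (\sum_(a <= k < b) c)).
  by rewrite big_nat [leRHS]big_nat; apply: ler_sum => k /andP[/Fc].
by rewrite sumr_const_nat -[_ *+ _]mulr_natl ler_wpM2r // ler_nat leq_subr.
Qed.

(** The terms are of order [1 / k] while the walk does not leave its tooth, and
    [1 / (k * tooth_size j)] later. *)
Lemma two_phase_sum (F : nat -> R) (A : R) j1 J : 0 <= A -> (0 < j1)%N ->
    (forall k, F k <= A) ->
    (forall k r, (0 < r)%N -> (48 * r * r <= k)%N -> F k <= A / r%:R ^+ 2) ->
    (forall k j, (j1 <= j)%N -> (96 * scale_time j <= k)%N ->
      F k <= A / (16 ^ j * tooth_size j)%:R ^+ 2) ->
    (forall k, 0 <= F k) ->
  \sum_(0 <= k < 96 * scale_time (j1 + J)) F k <=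
  A * (48 + 48 * 256 * (2 * j1 + 2)%:R) +
  A * (96 * 1024) * \sum_(j1 <= j < j1 + J) ((tooth_size j)%:R)^-1.
Proof.
move=> A0 j10 FA Fline Fbox F0.
have phase1 I : \sum_(0 <= k < 48 * (16 ^ I * 16 ^ I)) F k <= A * (48 + 48 * 256 * I%:R).
  elim: I => [|I IHI].
    by rewrite mulr0 addr0 mulrC; apply: sum_block_le => // k _.
  have q0 : (0 < 16 ^ I)%N by rewrite expn_gt0.
  rewrite (@big_cat_nat _ _ _ (48 * (16 ^ I * 16 ^ I))%N) //=; last first.
    by rewrite leq_mul2l leq_mul ?leq_exp2l.
  apply: (@le_trans _ _ (A * (48 + 48 * 256 * I%:R) + A * (48 * 256))).
    apply: lerD => //; set b := (48 * (16 ^ I.+1 * 16 ^ I.+1))%N.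
    rewrite (_ : A * (48 * 256) = b%:R * (A / (16 ^ I)%:R ^+ 2)).
      apply: sum_block_le => [|k kI]; first by rewrite divr_ge0 ?sqr_ge0.
      by apply: Fline => //; rewrite -mulnA.
    rewrite /b !expnS !natrM; field; rewrite pnatr_eq0 -lt0n //.
  by rewrite -natr1 le_eqVlt; apply/orP; left; apply/eqP; ring.
elim: J => [|J IHJ].
  rewrite addn0 [in leRHS]big_geq // mulr0 addr0.
  apply: le_trans (phase1 (2 * j1 + 2)%N).
  rewrite [leRHS](@big_cat_nat _ _ _ (96 * scale_time j1)%N) //=.
    by rewrite lerDl sumr_ge0.
  have ex : (tooth_size j1 <= 16 ^ j1)%N.
    by apply: leq_trans (tooth_size_le H_exp2 j1) _; apply: leq_trans (exp2_gt j1) (exp2_le16 j1).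
  have q0 : (0 < 16 ^ j1)%N by rewrite expn_gt0.
  have -> : (16 ^ (2 * j1 + 2) = 256 * (16 ^ j1 * 16 ^ j1))%N.
    by rewrite expnD mulnC mul2n -addnn expnD.
  rewrite scale_timeE; move: (16 ^ j1)%N (tooth_size j1) q0 ex => q a q0 aq.
  have : (q * q * a <= q * q * (q * q))%N.
    by rewrite leq_mul2l (leq_trans aq) ?orbT // leq_pmulr.
  by move: (q * q)%N => x; clear; lia.
rewrite addnS [leLHS](@big_cat_nat _ _ _ (96 * scale_time (j1 + J))%N) //=; last first.
  by have := scale_timeS H_mono (j1 + J); clear; lia.
set j := (j1 + J)%N.
suff block : \sum_(96 * scale_time j <= k < 96 * scale_time j.+1) F k <=
    A * (96 * 1024) * ((tooth_size j)%:R)^-1.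
  apply: le_trans (lerD IHJ block) _.
  rewrite [in leRHS]big_nat_recr ?leq_addr //= -/j.
  by rewrite le_eqVlt; apply/orP; left; apply/eqP; ring.
have q0 : (0 < 16 ^ j)%N by rewrite expn_gt0.
apply: le_trans (sum_block_le (c := A / (16 ^ j * tooth_size j)%:R ^+ 2) _ _ _) _.
- by rewrite divr_ge0 ?sqr_ge0.
- by move=> k kj; apply: Fbox => //; apply: leq_addr.
rewrite mulrCA -mulrA ler_wpM2l //.
have e0 : 0 < (tooth_size j)%:R :> R by rewrite ltr0n.
have r0 : 0 < (16 ^ j)%:R :> R by rewrite ltr0n.
rewrite ler_pdivrMr ?exprn_gt0 ?ltr0n ?muln_gt0 ?q0 //.
rewrite (_ : 96 * 1024 / _ * _ = (96 * 1024 * (16 ^ j * 16 ^ j * tooth_size j))%:R); last first.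
  by rewrite !natrM; field; rewrite gt_eqF.
rewrite ler_nat scale_timeE !expnS.
have := tooth_sizeS H_mono H_quart (leq_trans j10 (leq_addr J j1)); rewrite -/j.
move: (16 ^ j)%N (tooth_size j) (tooth_size j.+1) => q a b ab.
have : (q * q * b <= q * q * (4 * a))%N by rewrite leq_mul2l ab orbT.
rewrite (_ : 16 * q * (16 * q) * b = 256 * (q * q * b))%N; last by clear; lia.
by rewrite mulnCA; move: (q * q * b)%N (q * q * a)%N => x y; clear; lia.
Qed.

End Upper.

(** * Growth of the expected number of collisions *)

Section Growth.
Context {R : realType}.
Variable H : nat -> nat.
Hypothesis H_mono : {homo H : m n / (m <= n)%N}.
Hypothesis H_quart : forall m, ((H (m ^ 4)).+1 <= 4 * (H m).+1)%N.
Hypothesis H_exp2 : forall k, (H (2 ^ k) <= k)%N.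

Let e := comb H.
Let e_sym : symmetric e := comb_sym H.
Let e_fin : forall v, finite_set (nbhd e v) := @comb_fin H.

Local Notation tooth_size := (tooth_size H).
Local Notation scale_time := (scale_time H).

(** The order of the expected number of collisions up to time [2 ^ (10 * J)]. *)
Definition growth (J : nat) : R := \sum_(1 <= j < J.+1) ((tooth_size j)%:R)^-1.

Lemma inv_tooth_size_ge0 j : 0 <= ((tooth_size j)%:R)^-1 :> R.
Proof. by rewrite invr_ge0. Qed.

Lemma inv_tooth_size_le1 j : ((tooth_size j)%:R)^-1 <= 1 :> R.
Proof. by rewrite invf_le1 ?ler1n ?ltr0n tooth_size_gt0. Qed.

Lemma growth_ge0 J : 0 <= growth J.
Proof. by apply: sumr_ge0 => j _; apply: inv_tooth_size_ge0. Qed.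

Lemma growth_ge_half J : (0 < J)%N -> 1 / 2 <= growth J.
Proof.
move=> J0; rewrite /growth big_ltn //.
apply: (@le_trans _ _ ((tooth_size 1)%:R^-1)).
  by rewrite mul1r lef_pV2 ?posrE ?ltr0n // (ler_nat R _ 2) (tooth_size_le H_exp2 1).
by rewrite lerDl sumr_ge0 // => j _; apply: inv_tooth_size_ge0.
Qed.

(** The teeth have at most logarithmic height, so that [growth] dominates a harmonic
    sum. *)
Lemma ln_growth J : (0 < J)%N -> ln J.+1%:R <= 3 * growth J.
Proof.
have key K : ln (K.+2%:R / 2) <= growth K.
  elim: K => [|K IHK].
    by rewrite divff // ln1 /growth big_geq.
  rewrite /growth big_nat_recr //= -/(growth K).
  have -> : K.+3%:R / 2 = K.+2%:R / 2 * (1 + K.+2%:R^-1) :> R.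
    have : K.+2%:R != 0 :> R by rewrite pnatr_eq0.
    by rewrite -(natr1 K.+2); move: K.+2%:R => z z0; field.
  have p1 : 0 < K.+2%:R / 2 :> R by rewrite divr_gt0 // ltr0n.
  have p2 : 0 < 1 + K.+2%:R^-1 :> R by rewrite ltr_pwDl // invr_ge0.
  rewrite lnM ?posrE // lerD //.
  apply: (@le_trans _ _ (K.+2%:R^-1)).
    have := @le_ln1Dx R K.+2%:R^-1; apply.
    by rewrite (lt_le_trans _ (_ : 0 <= _)) ?invr_ge0 // ltrN10.
  by rewrite lef_pV2 ?posrE ?ltr0n // ler_nat (tooth_size_le H_exp2 K.+1).
move=> J0; have := key J; rewrite ln_div ?posrE ?ltr0n // => kJ.
have l2 : ln 2 <= 1 :> R.
  have := @le_ln1Dx R 1; rewrite (_ : 1 + 1 = 2) //; apply; lra.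
have half := growth_ge_half J0.
have : ln J.+1%:R <= ln J.+2%:R :> R by rewrite ler_ln ?posrE ?ltr0n // ler_nat.
lra.
Qed.

Lemma growth_unbounded (c : R) : exists J0, forall J, (J0 <= J)%N -> c <= growth J.
Proof.
exists (Num.truncn (expR (3 * c))).+1 => J JJ.
have J0 : (0 < J)%N by apply: leq_trans JJ.
have := ln_growth J0; suff : 3 * c <= ln J.+1%:R by lra.
rewrite -[leLHS]expRK ler_ln ?posrE ?expR_gt0 ?ltr0n //.
apply: ltW; apply: lt_le_trans (truncnS_gt _) _; rewrite ler_nat.
exact: leq_trans JJ _.
Qed.

Lemma growth_tail j0 : exists J0, forall J, (J0 <= J)%N ->
  growth J / 2 <= \sum_(j0 <= j < J.+1) ((tooth_size j)%:R)^-1.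
Proof.
have [J0 HJ0] := growth_unbounded (2 * j0%:R); exists (J0 + j0)%N => J JJ.
have := HJ0 J; rewrite (leq_trans _ JJ) ?leq_addr // => /(_ isT) big.
have : growth J <= j0%:R + \sum_(j0 <= j < J.+1) ((tooth_size j)%:R)^-1; last by lra.
case: j0 JJ big {HJ0} => [|j0] JJ big.
  by rewrite add0r [leRHS]big_ltn // lerDr inv_tooth_size_ge0.
rewrite /growth (@big_cat_nat _ _ _ j0.+1) //=; last by move: JJ; clear; lia.
rewrite lerD2r; apply: (@le_trans _ _ (\sum_(1 <= j < j0.+1) 1)).
  by apply: ler_sum => j _; apply: inv_tooth_size_le1.
by rewrite sumr_const_nat -[_ *+ _]mulr_natl mulr1 ler_nat; clear; lia.
Qed.

(** The terms decrease with [j]: each half of the range contributes at most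
    [growth J]. *)
Lemma growth_shift j1 J : (0 < j1)%N ->
  \sum_(j1 <= j < j1 + 2 * J) ((tooth_size j)%:R)^-1 <= 2 * growth J.
Proof.
move=> j10; have half a : (0 < a)%N ->
    \sum_(a <= j < a + J) ((tooth_size j)%:R)^-1 <= growth J.
  move=> a0; rewrite -{1}[a]add0n big_addn addKn /growth -{1}[1%N]add0n big_addn subn1 /=; apply: ler_sum => j _.
  rewrite lef_pV2 ?posrE ?ltr0n ?tooth_size_gt0 // ler_nat tooth_size_mono //.
  by rewrite leq_add2l.
rewrite (@big_cat_nat _ _ _ (j1 + J)%N) /=; [|clear; lia|clear; lia].
rewrite (_ : j1 + 2 * J = j1 + J + J)%N; last by clear; lia.
by have := half _ j10; have := half (j1 + J)%N (ltn_addr _ j10); lra.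
Qed.

Lemma scale_time_lt J : (2 <= J)%N -> (4 * scale_time J <= 2 ^ (10 * J))%N.
Proof.
move=> J2; have -> : (2 ^ (10 * J) = 16 ^ J * (16 ^ J * (2 ^ J * 2 ^ J)))%N.
  rewrite (_ : 16 = 2 ^ 4)%N // -!expnM -!expnD; congr (2 ^ _)%N; clear; lia.
have j4 : (4 <= 2 ^ J)%N by rewrite (_ : 4 = 2 ^ 2)%N // leq_exp2l.
have ts : (tooth_size J <= 2 ^ J)%N.
  exact: leq_trans (tooth_size_le H_exp2 J) (exp2_gt J).
have : (4 * tooth_size J <= 2 ^ J * 2 ^ J)%N by apply: leq_mul.
rewrite scale_timeE; move: (16 ^ J)%N (2 ^ J * 2 ^ J)%N (tooth_size J) => q y a ya.
have : (q * q * (4 * a) <= q * q * y)%N by rewrite leq_mul2l ya orbT.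
by rewrite !mulnA; clear; lia.
Qed.

(** The teeth within reach have height at most [10 * J + 2]: hence the first phase,
    during which the walks may stay in one tooth, ends at a scale [j1] of order
    [ln J], and contributes no more than a multiple of [growth J]. *)
Lemma hits_upper : exists2 C : R, 0 < C & exists J0, forall J k v, (J0 <= J)%N ->
  vertex H v -> (absz v.1 + k <= 2 ^ (10 * J).+1)%N ->
  hits (triple e) meet k (v, v, v) <= C * growth J.
Proof.
have [A A0 [Fc Fl Fb]] : exists2 A : R, 0 < A & [/\ forall n v, vertex H v -> coll e n v v v <= A,
    forall n v r, vertex H v -> (0 < r)%N -> (48 * r * r <= n)%N ->
      coll e n v v v <= A / r%:R ^+ 2 &
    forall n v K j, vertex H v -> (absz v.1 + n.+1 <= 2 ^ K)%N -> (K <= 16 ^ j)%N ->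
      (96 * scale_time j <= n)%N ->
      coll e n v v v <= A / (16 ^ j * tooth_size j)%:R ^+ 2].
  exists 1296; first by rewrite ltr0n.
  split; [exact: coll_le_cst | exact: coll_le_line | exact: coll_le_box].
have [J0 HJ0] := growth_unbounded 1.
exists (A * (48 + 48 * 256 * 80) + A * (96 * 1024) * 2); first by move: A0; lra.
exists (J0 + 2)%N => J k v JJ vv vk.
pose F i : R := (i <= k)%N%:R * coll e i v v v.
pose j1 := (trunc_log 16 (11 * J)).+1.
have J2 : (2 <= J)%N by move: JJ; clear; lia.
have K16 : (10 * J + 2 <= 16 ^ j1)%N.
  apply: leq_trans (ltnW (trunc_log_ltn _ (isT : (1 < 16)%N))).
  by move: J2; clear; lia.
have G1 : 1 <= growth J by apply: HJ0; move: JJ; clear; lia.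
have j1G : (2 * j1 + 2)%:R <= 80 * growth J.
  have l16 : (16 ^ trunc_log 16 (11 * J) <= 11 * J)%N.
    by apply: trunc_logP => //; move: J2; clear; lia.
  rewrite /j1; move: (trunc_log _ _) l16 => l l16.
  have hl : ln (2 ^+ (4 * l)) <= ln (11 * J.+1%:R) :> R.
    rewrite ler_ln ?posrE ?exprn_gt0 ?mulr_gt0 ?ltr0n //.
    rewrite -natrX -natrM ler_nat expnM (_ : 2 ^ 4 = 16)%N //.
    by apply: leq_trans l16 _; rewrite leq_mul2l leqnSn orbT.
  rewrite lnXn ?ltr0n // lnM ?posrE ?ltr0n // -[_ *+ _]mulr_natl natrM in hl.
  have ln11 : ln 11 <= 10 :> R.
    by have := @le_ln1Dx R 10; rewrite (_ : 1 + 10 = 11) ?lra; [apply; lra | lra].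
  have ln2 : 1 / 2 <= ln 2 :> R.
    have := @le_ln1Dx R (- (1 / 2)); rewrite (_ : 1 + - (1 / 2) = 2^-1); last by field.
    rewrite lnV ?posrE ?ltr0n // lerN2; apply; lra.
  have lG := ln_growth (leq_trans (isT : (0 < 2)%N) J2).
  have : 4 * l%:R * (1 / 2) <= 4 * l%:R * ln 2 :> R by rewrite ler_wpM2l // mulr_ge0.
  rewrite natrD natrM -natr1; move: hl; lra.
have kM : (k.+1 <= 96 * scale_time (j1 + 2 * J))%N.
  have st : (2 ^ (10 * J) <= scale_time (j1 + 2 * J))%N.
    apply: leq_trans (_ : 16 ^ (j1 + 2 * J) * 16 ^ (j1 + 2 * J) <= _)%N; last first.
      by rewrite scale_timeE leq_pmulr ?tooth_size_gt0.
    rewrite -expnD (_ : 16 = 2 ^ 4)%N // -expnM leq_exp2l //.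
    by move: j1 {K16 j1G} => j1; clear; lia.
  have p0 : (0 < 2 ^ (10 * J))%N by rewrite expn_gt0.
  move: vk; rewrite expnS; move: (absz v.1) st p0 => a.
  by move: (2 ^ _)%N (scale_time _) => x y; clear; lia.
have F0 i : 0 <= F i by rewrite mulr_ge0 // coll_ge0.
have F_le i b : 0 <= b -> ((i <= k)%N -> coll e i v v v <= b) -> F i <= b.
  by rewrite /F; case: (i <= k)%N => /= b0 h; rewrite ?mul1r ?mul0r // h.
have FF : hits (triple e) meet k (v, v, v) <=
    \sum_(0 <= i < 96 * scale_time (j1 + 2 * J)) F i.
  rewrite hits_meet // -(big_mkord predT (fun i => coll e i.+1 v v v)).
  rewrite [leRHS](@big_cat_nat _ _ _ k.+1) //= [in leRHS]big_ltn // -addrA.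
  rewrite [in leRHS]big_add1 /= [in leRHS](eq_big_nat _ _ (F2 := fun i => coll e i.+1 v v v)); last first.
    by move=> i /andP[_ ik]; rewrite /F ik mul1r.
  by rewrite addrCA lerDl addr_ge0 // sumr_ge0.
apply: le_trans FF _.
apply: le_trans (two_phase_sum H_mono H_quart H_exp2 (A := A) (j1 := j1) (2 * J) _ _ _ _ _ _) _ => //.
- exact: ltW.
- by move=> i; apply: F_le => [|_]; [apply: ltW|apply: Fc].
- move=> i r r0 ri; apply: F_le => [|_]; last exact: Fl.
  by rewrite divr_ge0 ?sqr_ge0 // ltW.
- move=> i j jj ji; apply: F_le => [|ik].
    by rewrite divr_ge0 ?sqr_ge0 // ltW.
  apply: (Fb i v (10 * J + 2)%N j) => //.
    rewrite addn2 expnS addnS; apply: leq_trans (_ : (2 ^ (10 * J).+1).+1 <= _)%N.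
      by rewrite ltnS; apply: leq_trans vk; rewrite leq_add2l.
    by rewrite mul2n -addnn -addn1 leq_add2l expn_gt0.
  by apply: leq_trans K16 _; rewrite leq_exp2l.
have sh := growth_shift J (ltn0Sn _ : (0 < j1)%N).
rewrite [leRHS]mulrDl lerD //.
  by rewrite -[leRHS]mulrA ler_pM2l //; move: j1G G1; lra.
have c0 : 0 <= A * (96 * 1024) by move: A0; lra.
by rewrite -[leRHS]mulrA; apply: ler_wpM2l c0 _ _ sh.
Qed.

End Growth.

(** * Many collisions are likely *)

Section Likely.
Context {R : realType}.
Variable H : nat -> nat.
Hypothesis H_mono : {homo H : m n / (m <= n)%N}.
Hypothesis H_quart : forall m, ((H (m ^ 4)).+1 <= 4 * (H m).+1)%N.
Hypothesis H_sqr : forall m, (H m ^ 2 <= m)%N.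
Hypothesis H_exp2 : forall k, (H (2 ^ k) <= k)%N.
Hypothesis H_4 : (0 < H 4)%N.

Let e := comb H.
Let e_sym : symmetric e := comb_sym H.
Let e_fin : forall v, finite_set (nbhd e v) := @comb_fin H.
Let deg_vertex : forall v, vertex H v -> (0 < degree e v)%N := @degree_vertex R H.

Local Notation growth := (@growth R H).

(** Walks that start in different classes of the bipartition never meet. *)
Definition meetable (z : int * int * (int * int) * (int * int)) : Prop :=
  [/\ vertex H z.1.1, vertex H z.1.2 & vertex H z.2] /\
  (colour z.1.2 = colour z.1.1 /\ colour z.2 = colour z.1.1).

Lemma meetable_step y z : meetable y -> triple e y z -> meetable z.
Proof.
move=> [_ [c12 c2]] /andP[/andP[e1 e2] e3]; split.
  by split; apply: vertex_comb; eassumption.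
by rewrite (comb_colour e1) (comb_colour e2) (comb_colour e3) c12 c2.
Qed.

Lemma degree_meetable z : meetable z -> (0 < degree (triple e) z)%N.
Proof. by move=> [[v1 v2 v3] _]; rewrite degree_triple // !muln_gt0 !deg_vertex. Qed.

(** The Paley-Zygmund inequality, with a mean of order at least [growth J] and, by
    the uniform bound from the diagonal, a second moment of order at most [growth J]
    times the mean.  The constants do not depend on the starting point. *)
Lemma hits_likely : exists c d : R, [/\ 0 < c, 0 < d &
  forall z, meetable z -> exists J0, forall J, (J0 <= J)%N ->
    d <= path_mean (triple e) (2 ^ (10 * J))
      (fun s => (c * growth J <= (count meet s)%:R)%R%:R) z].
Proof.
have tri_sym := triple_sym e_sym; have tri_fin := triple_fin e_fin.
have [C C0 [J1 HC]] := @hits_upper R H H_mono H_quart H_exp2.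
have [a [a0 lower]] : exists a : R, 0 < a /\
    forall z, meetable z -> exists J0, forall J, (J0 <= J)%N ->
      a * growth J <= hits (triple e) meet (2 ^ (10 * J)) z.
  exists (c_coll / 2); split; first by rewrite divr_gt0 ?c_coll_gt0.
  move=> [[u v] w] [[vu vv vw] [cv cw]].
  have [j0 Hj0] := hits_lower (R := R) H_mono H_quart H_sqr H_exp2 H_4 vu vv vw cv cw.
  have [J0 HJ0] := @growth_tail R H H_exp2 j0.
  exists (J0 + 2)%N => J JJ.
  have JJ0 : (J0 <= J)%N by move: JJ; clear; lia.
  have J2 : (2 <= J)%N by move: JJ; clear; lia.
  apply: le_trans (Hj0 J _ (scale_time_lt H_exp2 J2)).
  by rewrite -mulrA ler_pM2l ?c_coll_gt0 // mulrC HJ0.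
have [J2 HJ2] := growth_unbounded H_exp2 (1 : R).
pose b := 2 * C + 1; have b0 : 0 < b by rewrite /b; move: C0; lra.
exists (a / 2), (a / (4 * b)); split; rewrite ?divr_gt0 ?mulr_gt0 //.
move=> z mz; have [J0 HJ0] := lower z mz.
have [L HL] : exists L, (absz z.1.1.1 <= L)%N by exists (absz z.1.1.1).
exists (J0 + J1 + J2 + L)%N => J JJ.
have [JJ0 JJ1 JJ2 JL] : [/\ J0 <= J, J1 <= J, J2 <= J & L <= J]%N.
  by split; move: JJ; clear; lia.
set N := (2 ^ (10 * J))%N; set h : R := hits (triple e) meet N z.
have hG : a * growth J <= h by apply: HJ0.
have G1 : 1 <= growth J by apply: HJ2.
have h0 : 0 <= h by apply: le_trans hG; rewrite mulr_ge0 ?growth_ge0 // ltW.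
have NJ : (J <= N)%N.
  by apply: leq_trans (ltnW (exp2_gt J)) _; rewrite leq_exp2l // leq_pmull.
have second : path_mean (triple e) N (fun s => (count meet s)%:R ^+ 2) z <=
    (2 * (C * growth J) + 1) * h.
  apply: (hits_second_moment tri_sym tri_fin (I := fun k y =>
    meetable y /\ (absz y.1.1.1 + k <= 2 ^ (10 * J).+1)%N)).
  - move=> k x y [mx xk] xy; split; first exact: meetable_step mx xy.
    case/andP: xy => /andP[/comb_fst xy _] _.
    by move: xk xy; move: (absz x.1.1.1) (absz y.1.1.1) (2 ^ _)%N => p q r; clear; lia.
  - move=> k [[u v] w] [[[/= vu _ _] _] uk] /andP[/= /eqP<- /eqP<-].
    exact: HC.
  - split=> //; rewrite expnS -/N; move: HL JL NJ; move: (absz _) N {h hG h0} => p q.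
    by clear; lia.
have Gp : 0 < growth J by apply: lt_le_trans G1.
have bG : 0 < b * growth J by rewrite mulr_gt0.
have le_b : 2 * (C * growth J) + 1 <= b * growth J by rewrite /b; move: G1; lra.
have := paley_zygmund tri_sym tri_fin (degree_meetable mz) bG
  (le_trans second (ler_wpM2r h0 le_b)).
rewrite -/h => pz; apply: (@le_trans _ _ (h / (4 * (b * growth J)))).
  rewrite ler_pdivrMr ?mulr_gt0 // mulrAC ler_pdivlMr ?mulr_gt0 ?mulr_gt0 //.
  have -> : a * (4 * (b * growth J)) = a * growth J * (4 * b) by ring.
  by rewrite ler_pM2r ?mulr_gt0.
apply: le_trans pz _; apply: path_mean_le => // s _ _; rewrite ler_nat.
have hc : a / 2 * growth J <= h / 2.
  by rewrite mulrAC ler_pM2r // invr_gt0.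
by case: (leP (h / 2) _) => // hs; rewrite (le_trans hc hs).
Qed.

(** Makes thresholds uniform over the finitely many points that can be reached at a
    given time. *)
Lemma eventually_on_fset (V : choiceType) (S : seq V) (Q : V -> nat -> Prop) :
  (forall z, z \in S -> exists J0, forall J, (J0 <= J)%N -> Q z J) ->
  exists J0, forall z J, z \in S -> (J0 <= J)%N -> Q z J.
Proof.
elim: S => [|x S IHS] HS; first by exists 0%N.
have [J1 H1] := HS x (mem_head _ _).
have [z zS|J2 H2] := IHS; first by apply: HS; rewrite in_cons zS orbT.
exists (J1 + J2)%N => z J; rewrite in_cons => /orP[/eqP->|zS] JJ.
  by apply: H1; move: JJ; clear; lia.
by apply: H2 => //; move: JJ; clear; lia.
Qed.

Lemma path_reach (V : choiceType) (f : rel V) (f_fin : forall v, finite_set (nbhd f v))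
    (o : V) s : path f o s -> last o s \in reach f o (size s).
Proof.
elim/last_ind: s => [|s x IHs]; first by rewrite /= in_fset1.
rewrite rcons_path last_rcons size_rcons => /andP[/IHs sR sx].
exact: reach_nb sR sx.
Qed.

(** Each block of time is at least as long as the time before it, so that the rate at
    its end is of the order of the number of collisions that it is likely to bring. *)
Lemma comb_missed (g : nat -> R) (K : R) : 0 < K ->
    (forall J N, (2 <= J)%N -> (N <= 2 * 2 ^ (10 * J))%N -> g N <= K * growth J) ->
  exists eps d : R, [/\ 0 < eps, 0 < d, d <= 1 &
    forall Q m, exists2 N, (m <= N)%N &
      path_mean (triple e) N (fun s => (all (fun k =>
        (count meet (take k s))%:R < eps * g k) (iota m (N.+1 - m)))%:R)
        ((0, 0), (0, 0), (0, 0)) <= (1 - d) ^+ Q].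
Proof.
move=> K0 gK; set o := ((0, 0), (0, 0), (0, 0)).
have tri_sym := triple_sym e_sym; have tri_fin := triple_fin e_fin.
have [c [d [c0 d0 likely]]] := hits_likely.
have mo : meetable o by [].
have d1 : d <= 1.
  have [J0 HJ0] := likely o mo; apply: le_trans (HJ0 J0 (leqnn _)) _.
  rewrite -[leRHS](path_mean_cst tri_sym tri_fin (2 ^ (10 * J0)) 1 (degree_meetable mo)).
  by apply: path_mean_le => // s _ _; rewrite (ler_nat R _ 1) leq_b1.
exists (c / K), d; split => //; first exact: divr_gt0.
apply: (missed_targets tri_sym tri_fin (degree_meetable mo) d1) => m.
have [J0 HJ0] : exists J0, forall z J, z \in reach (triple e) o m -> (J0 <= J)%N ->
    meetable z -> d <= path_mean (triple e) (2 ^ (10 * J))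
      (fun s => (c * growth J <= (count meet s)%:R)%R%:R) z.
  apply: eventually_on_fset => z _.
  have [mz|nz] := pselect (meetable z); last by exists 0%N => J _ /nz.
  by have [J0 HJ0] := likely z mz; exists J0 => J /HJ0.
pose J := (J0 + m + 2)%N; exists (2 ^ (10 * J))%N => s sm os.
have ms : meetable (last o s).
  elim: s (o) mo os {sm} => [//|z s IHs] y my /= /andP[yz zs].
  exact: IHs (meetable_step my yz) zs.
have sR : last o s \in reach (triple e) o m by rewrite -sm; apply: path_reach.
apply: le_trans (HJ0 _ J sR _ ms) _; first by rewrite /J; clear; lia.
apply: path_mean_le => // s' _ _; rewrite ler_nat.
have mJ : (m <= 2 ^ (10 * J))%N.
  apply: leq_trans (_ : m <= J)%N _; first by rewrite /J; clear; lia.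
  by apply: leq_trans (ltnW (exp2_gt J)) _; rewrite leq_exp2l // leq_pmull.
case: (leP (c * growth J) _) => // cs.
rewrite (le_trans _ cs) // mulrAC ler_pdivrMr // -mulrA ler_pM2l // mulrC.
apply: gK; first by rewrite /J; clear; lia.
by rewrite mul2n -addnn leq_add2r.
Qed.

End Likely.

(** * Logarithmic teeth *)

Section LogHeight.
Context {R : realType}.
Variable alpha : R.
Hypothesis alpha01 : 0 < alpha <= 1.

Definition log_height (m : nat) : nat := Num.truncn (ln m%:R `^ alpha).

Let a0 : 0 < alpha. Proof. by case/andP: alpha01. Qed.
Let a1 : alpha <= 1. Proof. by case/andP: alpha01. Qed.

Let one_powR : 1 `^ alpha = 1. Proof. by rewrite powR1. Qed.

Lemma ln_nat_ge0 m : 0 <= ln m%:R :> R.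
Proof.
case: m => [|m]; first by rewrite ln0.
by rewrite ln_ge0 // ler1n.
Qed.

Lemma le_ln_nat m n : (m <= n)%N -> ln m%:R <= ln n%:R :> R.
Proof.
case: m => [|m] mn; first by rewrite ln0 // ln_nat_ge0.
by rewrite ler_ln ?posrE ?ltr0n ?(leq_trans _ mn) // ler_nat.
Qed.

Lemma powR_le_max (x : R) : 0 <= x -> x `^ alpha <= Num.max 1 x.
Proof.
move=> x0; rewrite le_max; have [x1|x1] := leP x 1.
  by rewrite -[leRHS]one_powR ge0_ler_powR ?nnegrE // ltW.
by rewrite ler1_powR ?orbT // ltW.
Qed.

Lemma truncn_log_lt m : ln m%:R `^ alpha < (log_height m).+1%:R.
Proof. exact: truncnS_gt. Qed.

Lemma log_height_le m : (log_height m)%:R <= ln m%:R `^ alpha.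
Proof. by rewrite truncn_le powR_ge0. Qed.

Lemma log_height_mono : {homo log_height : m n / (m <= n)%N}.
Proof.
move=> m n mn; apply: le_truncn; apply: ge0_ler_powR; rewrite ?nnegrE ?ln_nat_ge0 ?(ltW a0) //.
exact: le_ln_nat.
Qed.

Lemma log_height_quart m : ((log_height (m ^ 4)).+1 <= 4 * (log_height m).+1)%N.
Proof.
have lnE : ln (m ^ 4)%:R = 4 * ln m%:R :> R.
  case: m => [|m]; first by rewrite exp0n // ln0 // mulr0.
  by rewrite natrX lnXn ?ltr0n // -[LHS]mulr_natl.
rewrite -(ltr_nat R) (le_lt_trans (log_height_le _)) // lnE powRM ?ln_nat_ge0 //.
apply: (@le_lt_trans _ _ (4 * ln m%:R `^ alpha)).
  rewrite ler_wpM2r ?powR_ge0 //.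
  by rewrite ler1_powR // ler1n.
by rewrite natrM ltr_pM2l // truncn_log_lt.
Qed.

(** With [y = m ^ (1 / 4)]: [ln m <= 4 (y - 1) <= y ^ 2]. *)
Lemma sqr_ln_le m : ln m%:R ^+ 2 <= m%:R :> R.
Proof.
case: m => [|m]; first by rewrite ln0 // expr0n.
set x := ln _; have x0 : 0 <= x by exact: ln_nat_ge0.
have -> : m.+1%:R = expR (x / 4) ^+ 4.
  rewrite -expRM_natl mulrC divfK // lnK // posrE ltr0n //.
have h : x / 4 <= expR (x / 4) - 1 by have := expR_ge1Dx (x / 4); lra.
set y := expR _ in h *; have y0 : 0 < y by exact: expR_gt0.
have xy : x <= y ^+ 2 by have := sqr_ge0 (y - 2); lra.
rewrite (_ : 4 = 2 * 2)%N // exprM lerXn2r ?nnegrE // sqr_ge0 //.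
Qed.

Lemma log_height_sqr m : (log_height m ^ 2 <= m)%N.
Proof.
case: m => [|m].
  by rewrite /log_height ln0 // powR0 ?gt_eqF // truncn0.
rewrite -(ler_nat R) natrX.
have := le_trans (log_height_le m.+1) (powR_le_max (ln_nat_ge0 m.+1)).
rewrite le_max => /orP[h|h].
  apply: (@le_trans _ _ 1); last by rewrite ler1n.
  by rewrite exprn_ile1.
apply: le_trans (sqr_ln_le m.+1); rewrite lerXn2r ?nnegrE // ln_nat_ge0 //.
Qed.

Lemma ln2_le1 : ln 2 <= 1 :> R.
Proof. by have := @le_ln1Dx R 1; rewrite (_ : 1 + 1 = 2) //; apply; lra. Qed.

Lemma ln2_ge : 1 / 2 <= ln 2 :> R.
Proof.
have := @le_ln1Dx R (- (1 / 2)); rewrite (_ : 1 + - (1 / 2) = 2^-1); last by field.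
by rewrite lnV ?posrE ?ltr0n // lerN2; apply; lra.
Qed.

Lemma ln_exp2 k : ln (2 ^ k)%:R = k%:R * ln 2 :> R.
Proof. by rewrite natrX lnXn ?ltr0n // mulr_natl. Qed.

Lemma powR_exp2_le k : ln (2 ^ k)%:R `^ alpha <= k%:R `^ alpha.
Proof.
rewrite ln_exp2; apply: ge0_ler_powR; rewrite ?nnegrE ?(ltW a0) ?mulr_ge0 //.
  by have := ln2_ge; lra.
by rewrite ler_piMr // ln2_le1.
Qed.

Lemma log_height_exp2 k : (log_height (2 ^ k) <= k)%N.
Proof.
rewrite -(ler_nat R); apply: le_trans (log_height_le _) _.
case: k => [|k]; first by rewrite expn0 ln1 powR0 ?gt_eqF.
apply: le_trans (powR_exp2_le _) _; apply: le_trans (powR_le_max _) _ => //.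
by rewrite ge_max lexx ler1n.
Qed.

Lemma log_height_4 : (0 < log_height 4)%N.
Proof.
rewrite /log_height truncn_gt0 (_ : 4%:R = (2 ^ 2)%:R :> R) // ln_exp2.
rewrite -[leLHS]one_powR ge0_ler_powR ?nnegrE ?(ltW a0) //.
  by have := ln2_ge; lra.
by have := ln2_ge; lra.
Qed.

Lemma comb_adjE : comb_adj alpha = comb log_height.
Proof.
have vE v : comb_vertex alpha v = vertex log_height v.
  case: v => m [j|j] //; rewrite /comb_vertex /vertex /= /comb_height.
  have [->|m0] := eqVneq m 0.
    rewrite /= /log_height ln0 // powR0 ?gt_eqF // truncn0 leqn0.
    by rewrite -(pnatr_eq0 R) eq_le ler0n andbT.
  rewrite max_r ?powR_ge0 //.
  by rewrite /log_height truncn_ge_nat ?powR_ge0.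
by apply/funext => u; apply/funext => v; rewrite /comb_adj /comb !vE.
Qed.

Definition rate (N : nat) : R := Num.max (ln N%:R `^ (1 - alpha)) (ln (ln N%:R)).

(** [tooth_size j <= 2 * J ^ alpha] for all the [J] terms of the sum. *)
Lemma growth_powR J : (0 < J)%N -> J%:R `^ (1 - alpha) <= 2 * growth log_height J.
Proof.
move=> J0; have Jp : 0 < J%:R :> R by rewrite ltr0n.
have Ja : 0 < J%:R `^ alpha by rewrite powR_gt0.
have -> : J%:R `^ (1 - alpha) = 2 * \sum_(1 <= j < J.+1) (2 * J%:R `^ alpha)^-1.
  have -> : J%:R `^ (1 - alpha) = J%:R / J%:R `^ alpha.
    by rewrite powRB ?powRr1 //; apply/implyP => _; rewrite gt_eqF.
  rewrite sumr_const_nat subn1 /= -[_^-1 *+ _]mulr_natl.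
  by move: Ja; move: (_ `^ alpha) => z z0; field; rewrite gt_eqF.
rewrite ler_pM2l // /growth big_nat [leRHS]big_nat; apply: ler_sum => j /andP[j0 jJ].
rewrite lef_pV2 ?posrE ?ltr0n ?tooth_size_gt0 ?mulr_gt0 //.
apply: (@le_trans _ _ (1 + j%:R `^ alpha)).
  rewrite /tooth_size -natr1 addrC lerD2l; apply: le_trans (log_height_le _) _.
  exact: powR_exp2_le.
have jJ' : j%:R `^ alpha <= J%:R `^ alpha by rewrite ge0_ler_powR ?nnegrE ?(ltW a0) ?ler_nat.
have J1 : 1 <= J%:R `^ alpha by rewrite -[leLHS]one_powR ge0_ler_powR ?nnegrE ?(ltW a0) ?ler1n.
lra.
Qed.

(** The factor [2] in front of [2 ^ (10 * J)] leaves room for the time elapsed before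
    a block of that length. *)
Lemma rate_le J N : (2 <= J)%N -> (N <= 2 * 2 ^ (10 * J))%N ->
  rate N <= 23 * growth log_height J.
Proof.
move=> J2 NJ; have J0 : (0 < J)%N by apply: leq_trans J2.
have Jp : 0 < J%:R :> R by rewrite ltr0n.
have lnN : ln N%:R <= 11 * J%:R :> R.
  apply: le_trans (le_ln_nat NJ) _; rewrite -expnS ln_exp2.
  apply: (@le_trans _ _ ((10 * J).+1%:R)); first by rewrite ler_piMr // ln2_le1.
  by rewrite -natrM ler_nat; move: J2; clear; lia.
have half := growth_ge_half (R := R) log_height_exp2 J0.
rewrite ge_max; apply/andP; split.
  apply: (@le_trans _ _ ((11 * J%:R) `^ (1 - alpha))).
    by apply: ge0_ler_powR; rewrite ?nnegrE ?ln_nat_ge0 ?subr_ge0 // mulr_ge0.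
  rewrite powRM //; apply: (@le_trans _ _ (11 * (2 * growth log_height J))); last by lra.
  apply: ler_pM; rewrite ?powR_ge0 ?growth_powR //.
  rewrite -[leRHS]powRr1 // ler_powR //; first by rewrite ler1n.
  by rewrite gerBl ltW.
have lnG := ln_growth (R := R) log_height_exp2 J0.
have ln11 : ln 11 <= 10 :> R.
  by have := @le_ln1Dx R 10; rewrite (_ : 1 + 10 = 11) ?lra; [apply; lra | lra].
have [N0|N0] := leP (ln N%:R : R) 0; first by rewrite ln0 //; lra.
apply: (@le_trans _ _ (ln (11 * J%:R))).
  by rewrite ler_ln ?posrE // mulr_gt0.
rewrite lnM ?posrE ?ltr0n //.
have := @le_ln_nat J J.+1 (leqnSn J); lra.
Qed.

Lemma rate_gt0 N : (2 <= N)%N -> 0 < rate N.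
Proof.
move=> N2; rewrite lt_max powR_gt0 // ln_gt0 // ltr1n //.
Qed.

End LogHeight.

Lemma limn_esup_gt0 (R : realType) (u : nat -> R) (eps : R) : 0 < eps ->
    (forall m, exists2 k, (m <= k)%N & eps <= u k) ->
  (0 < limn_esup (fun n => (u n)%:E))%E.
Proof.
move=> eps0 Hu; apply: (@lt_le_trans _ _ eps%:E); first by rewrite lte_fin.
apply: le_ereal_inf_tmp => _ [A [m _ mA] <-].
have [k mk uk] := Hu m.
apply: (@le_trans _ _ (u k)%:E); first by rewrite lee_fin.
by apply: ereal_sup_ubound; exists k => //; apply: mA.
Qed.

Theorem theorem1p2 (R : realType) (alpha : R) (halpha : 0 < alpha <= 1)
    (d : measure_display) (T : measurableType d) (P : probability T R)
    (X Y Z : nat -> T -> int * int)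
    (hX : simple_random_walk (comb_adj alpha) P X (0, 0))
    (hY : simple_random_walk (comb_adj alpha) P Y (0, 0))
    (hZ : simple_random_walk (comb_adj alpha) P Z (0, 0))
    (hind : independent3 P X Y Z) :
  {ae P, forall t,
    (0 < limn_esup (fun N : nat =>
       ((triple_collisions X Y Z N t)%:R /
        Num.max (ln N%:R `^ (1 - alpha)) (ln (ln N%:R)))%:E))%E}.
Proof.
pose H := log_height alpha.
have H_mono := log_height_mono halpha; have H_exp2 := log_height_exp2 halpha.
rewrite (comb_adjE halpha) in hX hY hZ; pose e := comb H.
have e_fin : forall v, finite_set (nbhd e v) := @comb_fin H.
have [eps [del [eps0 del0 del1 missed]]] := comb_missed H_mono
  (log_height_quart halpha) (log_height_sqr halpha) H_exp2 (log_height_4 halpha)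
  (ltr0Sn R 22) (rate_le halpha).
pose W := joint X Y Z.
have [W_meas W_start W_step] : simple_random_walk (triple e) P W ((0, 0), (0, 0), (0, 0)).
  exact: joint_srw.
have W_path := srw_path (triple_fin e_fin) W_meas W_step W_start.
have collE N k t : (k <= N)%N -> triple_collisions X Y Z k t =
    count meet (take k [seq W i t | i <- iota 1 N]).
  move=> kN; rewrite -map_take take_iota (minn_idPl kN) count_map -sum1_count.
  rewrite /triple_collisions [RHS]big_mkcond /= /index_iota subn1 /=.
  by apply: eq_bigr => n _; rewrite /W /joint /meet /=; case: (_ && _).
(* [low m]: from time [m] on, the collisions stay below the rate. *)
pose low m := [set t | forall k, (m <= k)%N ->
  (triple_collisions X Y Z k t)%:R < eps * rate alpha k].
apply: (@negligibleS _ _ _ _ (\bigcup_m low m)).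
  move=> t; apply: contra_notP => low_t; apply: (@limn_esup_gt0 _ _ eps) => // m.
  apply: contrapT => Hm; apply: low_t; exists (m + 2)%N => // k mk.
  rewrite ltNge; apply/negP => hk; apply: Hm; exists k; first by move: mk; clear; lia.
  rewrite ler_pdivlMr //; apply: rate_gt0; move: mk; clear; lia.
apply: negligible_bigcup => m.
(* On [low m] the targets are missed in each of any number of blocks after [m]. *)
have /choice[A HA] Q : exists A, [/\ measurable A, low m `<=` A &
    (P A <= ((1 - del) ^+ Q)%:E)%E].
  have [N mN HN] := missed Q m.
  pose D (s : seq (int * int * (int * int) * (int * int))) := all (fun k =>
    (count meet (take k s))%:R < eps * rate alpha k) (iota m (N.+1 - m)).
  exists [set t | D [seq W i t | i <- iota 1 N]].
  split; [exact: (measurable_path W_meas) | | by rewrite W_path lee_fin].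
  move=> t low_t /=; apply/allP => k; rewrite mem_iota => /andP[mk kN].
  rewrite -collE; first exact: low_t.
  by move: kN mk mN; clear; lia.
have mA : measurable (\bigcap_Q A Q) by apply: bigcapT_measurable => Q; case: (HA Q).
exists (\bigcap_Q A Q); split => //; last by move=> t low_t Q _; case: (HA Q) => _ + _; apply.
apply/eqP; rewrite eq_le measure_ge0 andbT.
have PA Q : (P (\bigcap_Q A Q) <= ((1 - del) ^+ Q)%:E)%E.
  have [mAQ _ AQ] := HA Q; apply: le_trans AQ; apply: le_measure; rewrite ?inE //.
  exact: bigcap_inf.
have [p pE] : exists p : R, P (\bigcap_Q A Q) = p%:E.
  by exists (fine (P (\bigcap_Q A Q))); rewrite fineK // fin_num_measure.
suff : p <= 0 by rewrite -lee_fin -pE.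
have r1 : `|1 - del| < 1 by rewrite ger0_norm ?subr_ge0 // gtrBl.
rewrite -(cvg_lim _ (cvg_expr r1)) //.
apply: limr_ge; first by apply/cvg_ex; exists 0; apply: cvg_expr.
by apply: nearW => Q; rewrite -lee_fin -pE.
Qed.
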